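(* Let $q$ be a positive integer, let $m \in \mathbb{Z}$ with $m \geq 3$, and let $\mathbf{f} \in \tfrac1q\mathbb{Z}^2$ with $\mathbf f\notin\mathbb{Z}^2$. Let $\pi\colon \mathbb{R}^2\to\mathbb{R}$ be a minimal valid function for $R_{\mathbf f}(\mathbb{R}^2,\mathbb{Z}^2)$ that is continuous piecewise linear over $\mathcal{P}_q$. Then the following are equivalent: (1) $\pi$ is a facet for $R_{\mathbf f}(\mathbb{R}^2,\mathbb{Z}^2)$; (2) $\pi$ is extreme for $R_{\mathbf f}(\mathbb{R}^2,\mathbb{Z}^2)$; (3) the restriction $\pi|_{\frac{1}{mq}\mathbb{Z}^2}$ is extreme for $R_{\mathbf f}(\tfrac{1}{mq}\mathbb{Z}^2,\mathbb{Z}^2)$.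
   Context: Group problem. Let $G$ be an abelian group (written additively), $S$ a subgroup of $G$, and $\mathbf f\in G\setminus S$. A feasible solution is a function $y\colon G\to\mathbb{Z}_{\ge 0}$ of finite support with $\sum_{\mathbf r\in G}\mathbf r\,y(\mathbf r)\in \mathbf f+S$. $R_{\mathbf f}(G,S)$ denotes the convex hull, in the space of finitely supported functions $G\to\mathbb{R}$, of the set of feasible solutions. Valid function: a function $\pi\colon G\to\mathbb{R}$ with $\pi\ge 0$ such that $\sum_{\mathbf r\in G}\pi(\mathbf r)y(\mathbf r)\ge 1$ for all $y\in R_{\mathbf f}(G,S)$. Minimal: a valid function $\pi$ is minimal if there is no valid function $\pi'\ne\pi$ with $\pi'(\mathbf r)\le\pi(\mathbf r)$ for all $\mathbf r\in G$. Extreme: a valid function $\pi$ is extreme if whenever $\pi=\tfrac12(\pi^1+\pi^2)$ with $\pi^1,\pi^2$ valid functions, then $\pi=\pi^1=\pi^2$. Facet: for a valid function $\pi$ let $P(\pi)$ be the set of feasible solutions $y$ with $\sum_{\mathbf r\in G}\pi(\mathbf r)y(\mathbf r)=1$. A valid function $\pi$ is a facet if for every valid function $\pi'$ with $P(\pi)\subseteq P(\pi')$ we have $\pi'=\pi$. The complex $\mathcal P_q$: consider the arrangement of all lines in $\mathbb{R}^2$ of the form $x_2=b$, $x_1=b$, and $x_1+x_2=b$ with $b\in\tfrac1q\mathbb{Z}$. The closures of the cells of its complement are the triangles $\tfrac1q\operatorname{conv}\{(0,0),(1,0),(0,1)\}$ and $\tfrac1q\operatorname{conv}\{(1,0),(0,1),(1,1)\}$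 and their translates by elements of $\tfrac1q\mathbb{Z}^2$. $\mathcal P_q$ is the polyhedral complex consisting of these triangles, all their edges and vertices, and the empty set; it is a triangulation of $\mathbb{R}^2$. A function $\pi\colon\mathbb{R}^2\to\mathbb{R}$ is continuous piecewise linear over $\mathcal P_q$ if it is affine on each (closed) triangle of $\mathcal P_q$. *)

(* Defs.v *)
From HB Require Import structures.
From mathcomp Require Import all_boot all_order all_algebra.
From mathcomp Require Import boolp classical_sets functions cardinality fsbigop.
From mathcomp Require Import reals.

Set Implicit Arguments.
Unset Strict Implicit.
Unset Printing Implicit Defensive.

Import Order.TTheory GRing.Theory Num.Theory.

Local Open Scope classical_set_scope.
Local Open Scope ring_scope.

Definition convex_hull (R : realType) (V : lmodType R) (A : set V) : set V :=
  [set v | exists n (c : 'I_n -> R) (a : 'I_n -> V),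
    [/\ forall i, 0 <= c i, \sum_i c i = 1, forall i, A (a i)
      & v = \sum_i c i *: a i]].

(* In the sums over [set: G] below all but finitely many terms are zero. *)
Definition feasible (G : zmodType) (S : zmodClosed G) (f : G) : set (G -> nat) :=
  [set y | finite_set [set r | y r <> 0%N] /\
    exists2 s, s \in S & \sum_(r \in [set: G]) r *+ y r = f + s].

Definition group_hull (R : realType) (G : zmodType) (S : zmodClosed G) (f : G)
    : set (G -> R^o) :=
  convex_hull [set (fun r => (y r)%:R : R^o) | y in feasible S f].

Section GroupProblem.
Variables (R : realType) (G : zmodType) (S : zmodClosed G) (f : G).
Implicit Types pi : G -> R.

Definition valid pi : Prop :=
  (forall r, 0 <= pi r) /\
  forall y, group_hull S f y -> 1 <= \sum_(r \in [set: G]) pi r * y r.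

Definition minimal pi : Prop :=
  valid pi /\
  ~ exists pi', [/\ valid pi', pi' <> pi & forall r, pi' r <= pi r].

Definition extreme pi : Prop :=
  valid pi /\
  forall pi1 pi2, valid pi1 -> valid pi2 ->
    pi = (fun r => 2^-1 * (pi1 r + pi2 r)) -> pi = pi1 /\ pi = pi2.

Definition tight_set pi : set (G -> nat) :=
  [set y | feasible S f y /\ \sum_(r \in [set: G]) pi r * (y r)%:R = 1].

Definition facet pi : Prop :=
  valid pi /\
  forall pi', valid pi' -> tight_set pi `<=` tight_set pi' -> pi' = pi.

End GroupProblem.

(* For 0 < n this is the subgroup (1/n) Z^2 of R^2; in particular Z^2 is
   [lattice R 1]. *)
Definition lattice (R : realType) (n : nat) : {pred 'rV[R]_2} :=
  [pred x : 'rV[R]_2 | [forall i, n%:R * x 0 i \is a Num.int]].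
Arguments lattice : clear implicits.

Lemma lattice_zmod_closed (R : realType) (n : nat) :
  zmod_closed (lattice R n).
Proof.
split=> [|x y /forallP xP /forallP yP]; apply/forallP => i; rewrite !mxE.
  by rewrite mulr0 rpred0.
by rewrite mulrBr rpredB.
Qed.

HB.instance Definition _ (R : realType) (n : nat) :=
  GRing.isZmodClosed.Build 'rV[R]_2 (lattice R n) (lattice_zmod_closed R n).

Lemma lattice_mul (R : realType) (m n : nat) (x : 'rV[R]_2) :
  x \in lattice R n -> x \in lattice R (m * n).
Proof.
move=> /forallP xP; apply/forallP => i.
by rewrite natrM -mulrA rpredM ?rpred_nat.
Qed.

(* (1/n) Z^2 as an abelian group in its own right *)
Record latticeType (R : realType) (n : nat) :=
  Lattice { lattice_val : 'rV[R]_2; _ : lattice_val \in lattice R n }.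

HB.instance Definition _ (R : realType) (n : nat) :=
  [isSub for @lattice_val R n].
HB.instance Definition _ (R : realType) (n : nat) :=
  [Choice of latticeType R n by <:].
HB.instance Definition _ (R : realType) (n : nat) :=
  [SubChoice_isSubZmodule of latticeType R n by <:].

(* Z^2 as a subgroup of (1/n) Z^2 *)
Definition integral_points (R : realType) (n : nat) : {pred latticeType R n} :=
  [pred x | val x \in lattice R 1].
Arguments integral_points : clear implicits.

Lemma integral_points_zmod_closed (R : realType) (n : nat) :
  zmod_closed (integral_points R n).
Proof.
split=> [|x y]; rewrite /in_mem /=; first exact: rpred0.
exact: rpredB.
Qed.

HB.instance Definition _ (R : realType) (n : nat) :=
  GRing.isZmodClosed.Build (latticeType R n) (integral_points R n)
    (integral_points_zmod_closed R n).

Section PiecewiseLinear.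
Variables (R : realType) (q : nat).

Let e1 : 'rV[R]_2 := delta_mx 0 0.
Let e2 : 'rV[R]_2 := delta_mx 0 1.

Definition scale_translate (v : 'rV[R]_2) (A : set 'rV[R]_2) : set 'rV[R]_2 :=
  [set v + q%:R^-1 *: x | x in A].

(* The closures of the cells cut out in R^2 by the lines x_1 = b, x_2 = b and
   x_1 + x_2 = b, with b in (1/q) Z. *)
Definition triangles : set (set 'rV[R]_2) :=
  [set T | exists2 v, v \in lattice R q &
    T = scale_translate v (convex_hull [set 0; e1; e2]) \/
    T = scale_translate v (convex_hull [set e1; e2; e1 + e2])].

Definition affine_on (T : set 'rV[R]_2) (pi : 'rV[R]_2 -> R) : Prop :=
  exists (a : 'cV[R]_2) (b : R), forall x, T x -> pi x = (x *m a) 0 0 + b.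

(* This implies continuity: the closed triangles are a locally finite cover. *)
Definition cpwl (pi : 'rV[R]_2 -> R) : Prop :=
  forall T, triangles T -> affine_on T pi.

End PiecewiseLinear.

(* Main.v *)
Require Import Defs.
From mathcomp Require Import all_boot all_order all_algebra.
From mathcomp Require Import boolp classical_sets functions cardinality fsbigop.
From mathcomp Require Import reals.
From mathcomp Require Import ring lra.

Set Implicit Arguments.
Unset Strict Implicit.
Unset Printing Implicit Defensive.

Import Order.TTheory GRing.Theory Num.Theory.

Local Open Scope ring_scope.

(** Why the theorem holds.

    Call g regular if it is nonnegative, vanishes on S, is subadditive and
    satisfies g x + g (f - x) = 1.  Minimal functions are regular
    ([minimal_regular]), regular functions are valid, and a valid function
    whose tight set contains that of a regular one is regular too
    ([tight_regular]).  So validity and tightness can be read off from triples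
    x + y + w = f, whose pi-sum is at least 1; such a triple is tight when the
    sum is 1.  A facet is extreme because the tight solutions of a midpoint of
    two valid functions are tight for both.

    After scaling, a point of the plane is encoded as a triple of reals with
    sum 0, chosen such that the lines of the complex are exactly the sets
    where one coordinate is an integer.  A triple x, y, w with integral sum
    is then a real 3 x 3 matrix with integral row and column sums, that is, a
    flow on the bipartite graph K_{3,3}.  Flows can be rounded along cycles
    without leaving the cells of the rows ([round_matrix]); hence an inequality
    between sums of three cellwise affine functions need only be checked at
    vertices.

    Extreme implies that the restriction is extreme: if the restriction to the
    grid is the midpoint of two valid functions, interpolate both linearly on
    the triangles.  By rounding, the interpolants are regular, hence valid, and
    their midpoint is pi ([extreme_restriction]).

    If the restriction is extreme, pi is a facet.  Let pi' be valid with the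
    tight solutions of pi, and phi = pi' - pi: a bounded periodic function with
    phi x + phi y + phi w = 0 on tight triples.  A nonzero periodic solution
    of this equation on the grid could be added to and subtracted from pi with
    a small factor, since up to periods there are only finitely many grid
    triples ([extreme_no_perturbation]).  So phi vanishes on the grid, in
    particular at the vertices of the triangles.  Suppose phi is nonzero
    somewhere.  Tightness at (x, y, w) spreads to the product of the closed
    cells of x, y and w ([tight_face]), so phi solves a functional equation on
    these cells, according to the position of the cells:
    - if one cell is a vertex, the equation is an odd reflection of a cell;
    - for three parallel edges, or three triangles, phi is zero on them;
    - for an edge and two triangles, phi is zero on the edge and depends on one
      barycentric coordinate on the triangles;
    - for two nonparallel edges and a triangle, phi is on the triangle the sum
      of the two edge functions, each in one barycentric coordinate;
    - for three edges of different directions, phi x + phi y + phi w = 0 at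
      corresponding parameters.
    The only analytic input is that a bounded additive function on [0, 1]
    which vanishes at 1 is zero ([additive_unit_zero]).  All surviving
    relations are pointwise in the parameters of the edges.  They are therefore
    preserved when the values at the parameters t0 and 1 - t0 of every edge are
    moved to the parameters 1/m and 1 - 1/m, all other values on edges are set
    to 0, and the triangles on which phi is a sum of one-variable functions
    follow suit; on every other triangle only odd reflections matter, and a
    value at a freely chosen point c0 is moved to the point with coordinates
    (1/m, 1/m, 1 - 2/m).  The result [psi] solves the same equation
    ([psi_tight]), and t0 or c0 can be chosen such that it is nonzero at a grid
    point ([psi_nonvanishing]): a contradiction.  For m >= 3 the parameters 1/m
    and 1 - 1/m are distinct, and the point that receives the value at c0 is
    interior to its triangle. *)

(** * Valid functions of an abelian group *)

Section GroupTheory.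
Variables (R : realType) (G : zmodType) (S : zmodClosed G) (f : G).
Implicit Types (g h : G -> R) (l : seq G) (x y w : G).

Lemma fsum_count_mem (V : zmodType) (F : G -> nat -> V) l :
    (forall r, F r 0%N = 0) ->
  \sum_(r \in [set: G]) F r (count_mem r l) =
  \sum_(r <- undup l) F r (count_mem r l).
Proof.
move=> F0; rewrite [RHS]fsbig_seq ?undup_uniq //; apply/esym.
apply: (fsbig_widen [set` undup l]%classic [set: G]) => [//|r /= [_]].
rewrite mem_undup => /negP rl.
by rewrite (count_memPn rl) F0.
Qed.

Lemma fsum_mul_count_mem g l :
  \sum_(r \in [set: G]) g r * (count_mem r l)%:R = \sum_(r <- l) g r.
Proof.
rewrite (@fsum_count_mem _ (fun r n => g r * n%:R)) => [|r]; last exact: mulr0.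
rewrite -[RHS]big_undup_iterop_count /=; apply: eq_bigr => r _.
by rewrite mulr_natr.
Qed.

Lemma fsum_mulrn_count_mem l :
  \sum_(r \in [set: G]) r *+ count_mem r l = \sum_(r <- l) r.
Proof.
rewrite (@fsum_count_mem _ (fun r n => r *+ n)) //.
rewrite -[RHS]big_undup_iterop_count /=; apply: eq_bigr => r _.
by [].
Qed.

Lemma finite_support_count_mem (y : G -> nat) :
  finite_set [set r | y r <> 0%N]%classic ->
  exists l, y = fun r => count_mem r l.
Proof.
move=> /finite_seqP[s ys].
exists (flatten [seq nseq (y r) r | r <- undup s]); apply/funext => r.
rewrite count_flatten -!map_comp sumnE big_map.
have [rs|rs] := boolP (r \in s).
  rewrite (bigD1_seq r) ?mem_undup ?undup_uniq //= count_nseq /= eqxx mul1n.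
  rewrite big1 ?addn0 // => i ir; rewrite /= count_nseq /=.
  by rewrite (negPf ir).
rewrite big_seq big1 => [|i]; last first.
  rewrite mem_undup /= count_nseq /= => si; case: eqVneq => [ir|//].
  by rewrite -ir si in rs.
case: (eqVneq (y r) 0%N) => // /eqP yr.
have : [set` s]%classic r by rewrite -ys.
by rewrite /= (negPf rs).
Qed.

Definition feasible_seq l := (\sum_(r <- l) r) - f \in S.

Lemma feasible_count_mem l :
  feasible S f (fun r => count_mem r l) <-> feasible_seq l.
Proof.
rewrite /feasible_seq; split => [[_ [s sS]]|lS].
  by rewrite fsum_mulrn_count_mem => ->; rewrite addrC addKr.
split; last by eexists; [exact: lS | rewrite fsum_mulrn_count_mem addrC subrK].
apply: (sub_finite_set _ (finite_seq l)) => r /=.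
by apply: contra_notT => /count_memPn.
Qed.

(** Feasible solutions are finite multisets, so they can be handled as lists;
    passing to the convex hull adds nothing since the constraints are linear. *)
Lemma validP g :
  valid S f g <->
  (forall r, 0 <= g r) /\
  (forall l, feasible_seq l -> 1 <= \sum_(r <- l) g r).
Proof.
split=> -[g0 gv]; (split=> //); [move=> l lS|move=> y].
  rewrite -fsum_mul_count_mem; apply: gv; exists 1%N, (fun=> 1).
  exists (fun=> (fun r => (count_mem r l)%:R)); split => //.
  - by rewrite big_ord1.
  - by move=> _; exists (fun r => count_mem r l) => //;
    apply/feasible_count_mem.
  - by rewrite big_ord1 scale1r.
case=> n [c [a [c0 c1 aA ->]]].
have lP (i : 'I_n) : exists l, feasible_seq l /\
    a i = (fun r => (count_mem r l)%:R).
  case: (aA i) => z [zfin zS] <-.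
  have [l zl] := finite_support_count_mem zfin.
  by exists l; split; [apply/feasible_count_mem; rewrite -zl | rewrite zl].
have [l lE] := choice lP.
pose L := undup (flatten (codom l)).
have LP i r : r \in l i -> r \in L.
  by move=> ri; rewrite mem_undup; apply/flattenP; exists (l i) => //;
     exact: codom_f.
have aE r : (\sum_i c i *: a i) r = \sum_i c i * (count_mem r (l i))%:R.
  rewrite (@fct_sumE _ _ _ _ _ (fun i => c i *: a i)); apply: eq_bigr => i _.
  by rewrite (lE i).2.
have suppL (F : G -> R) : (forall r, r \notin L -> F r = 0) ->
    \sum_(r \in [set: G]) F r = \sum_(r <- L) F r.
  move=> FL; rewrite [RHS]fsbig_seq ?undup_uniq //; apply/esym.
  by apply: (fsbig_widen [set` L]%classic [set: G]) => // r /= [_ /negP];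
    exact: FL.
rewrite suppL; last first.
  move=> r rL; rewrite aE big1 ?mulr0 // => i _.
  have /count_memPn -> : r \notin l i by apply: contra rL; exact: LP.
  by rewrite mulr0.
have -> : \sum_(r <- L) g r * (\sum_i c i *: a i) r =
          \sum_i c i * (\sum_(r <- l i) g r).
  under eq_bigr => r _ do rewrite aE mulr_sumr.
  rewrite exchange_big /=; apply: eq_bigr => i _.
  rewrite -[in RHS]fsum_mul_count_mem suppL; last first.
    move=> r rL.
    have /count_memPn -> : r \notin l i by apply: contra rL; exact: LP.
    by rewrite mulr0.
  by rewrite mulr_sumr; apply: eq_bigr => r _; rewrite mulrCA.
rewrite -c1; apply: ler_sum => i _; rewrite ler_peMr //.
exact: gv (lE i).1.
Qed.

Lemma tight_set_sub g h :
    (forall l, feasible_seq l -> \sum_(r <- l) g r = 1 ->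
      \sum_(r <- l) h r = 1) <->
  (tight_set S f g `<=` tight_set S f h)%classic.
Proof.
split=> gh => [y [yS yg]|l lS lg].
  have [l yl] := finite_support_count_mem yS.1.
  split=> //; subst y; move: yS yg => /feasible_count_mem lS.
  by rewrite !fsum_mul_count_mem; exact: gh.
have [|_ ] := gh (fun r => count_mem r l).
  by split; [exact/feasible_count_mem | rewrite fsum_mul_count_mem].
by rewrite fsum_mul_count_mem.
Qed.

Definition regular g := [/\ forall r, 0 <= g r,
  forall s, s \in S -> g s = 0,
  forall x y, g (x + y) <= g x + g y &
  forall x, g x + g (f - x) = 1].

(** Subadditivity gives one inequality, applied to s and to - s. *)
Lemma subadditive_period g x s : (forall t, t \in S -> g t = 0) ->
  (forall x y, g (x + y) <= g x + g y) -> s \in S -> g (x + s) = g x.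
Proof.
move=> gS gD sS; apply/eqP; rewrite eq_le; apply/andP; split.
  by rewrite (le_trans (gD _ _)) // (gS s) // addr0.
by rewrite -{1}(addrK s x) (le_trans (gD _ _)) // (gS (- s)) ?addr0 ?rpredN.
Qed.

Lemma subadditive_sum g l : g 0 = 0 ->
  (forall x y, g (x + y) <= g x + g y) ->
  g (\sum_(r <- l) r) <= \sum_(r <- l) g r.
Proof.
move=> g0 gD; elim: l => [|r l IH]; first by rewrite !big_nil g0.
by rewrite !big_cons (le_trans (gD _ _)) // lerD2l.
Qed.

Lemma regularD g x s : regular g -> s \in S -> g (x + s) = g x.
Proof. by move=> [_ gS gD _]; exact: subadditive_period. Qed.

Lemma regular_triple g x y w :
  regular g -> x + y + w = f -> 1 <= g x + g y + g w.
Proof.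
move=> [g0 gS gD gf] /(canRL (addrK _)) xyw.
have := gf w; rewrite -xyw => <-.
by rewrite addrC lerD2r gD.
Qed.

Lemma regular_valid g : regular g -> valid S f g.
Proof.
move=> gR; have [g0 gS gD gf] := gR; apply/validP; split=> // l lS.
have gsum := @subadditive_sum g l (gS 0 (rpred0 S)) gD.
rewrite (le_trans _ gsum) // -(subrK f (\sum_(r <- l) r)) addrC regularD //.
by have := gf 0; rewrite subr0 gS ?rpred0 // add0r => ->.
Qed.

Lemma minimal_le g h :
  minimal S f g -> valid S f h -> (forall r, h r <= g r) -> h = g.
Proof.
move=> [_ gmin] hv hg; apply: contrapT => hNg; apply: gmin.
by exists h.
Qed.

(** Each property is obtained by lowering g at one kind of element and checking
    that the result is still valid: on S, where elements can be dropped from a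
    feasible list; at x + y, which can be replaced by the two elements x and y;
    and at a point x with g x + g (f - x) > 1. *)
Lemma minimal_regular g : minimal S f g -> regular g.
Proof.
move=> gmin; have /validP[g0 gv] := gmin.1.
have gS s : s \in S -> g s = 0.
  move=> sS; pose h r := if r \in S then 0 else g r.
  suff <- : h = g by rewrite /h sS.
  apply: minimal_le => // [|r]; last by rewrite /h; case: ifP.
  apply/validP; split=> [r|l]; first by rewrite /h; case: ifP.
  rewrite /feasible_seq (bigID (mem S)) /= -addrA => lS.
  have -> : \sum_(r <- l) h r = \sum_(r <- [seq r <- l | r \notin S]) g r.
    rewrite big_filter [RHS]big_mkcond /=; apply: eq_bigr => r _.
    by rewrite /h; case: ifP.
  apply: gv; rewrite /feasible_seq big_filter.
  by move: lS; rewrite rpredDl //; apply: rpred_sum.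
have gD x y : g (x + y) <= g x + g y.
  rewrite leNgt; apply/negP => gxy.
  pose h r := if r == x + y then g x + g y else g r.
  suff hg : h = g by move: gxy; rewrite -[in X in _ < X]hg /h eqxx ltxx.
  apply: minimal_le => // [|r]; last first.
    by rewrite /h; case: eqP => // ->; exact: ltW.
  apply/validP; split=> [r|l lS].
    by rewrite /h; case: ifP => // _; rewrite addr_ge0.
  pose t r := if r == x + y then [:: x; y] else [:: r].
  have tE (V : zmodType) (k : G -> V) :
      \sum_(r <- flatten (map t l)) k r =
      \sum_(r <- l) if r == x + y then k x + k y else k r.
    rewrite big_flatten big_map; apply: eq_bigr => r _; rewrite /t.
    by case: (r == x + y); rewrite !big_cons big_nil /= addr0.
  rewrite -(tE _ g); apply: gv; rewrite /feasible_seq tE.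
  suff -> : \sum_(r <- l) (if r == x + y then x + y else r) = \sum_(r <- l) r.
    by [].
  by apply: eq_bigr => r _; case: eqP.
have gper x s : s \in S -> g (x + s) = g x by exact: subadditive_period.
have gsum l := @subadditive_sum g l (gS 0 (rpred0 S)) gD.
have g1 x : 1 <= g x + g (f - x).
  have := gv [:: x; f - x]; rewrite /feasible_seq !big_cons !big_nil !addr0.
  by apply; rewrite subrKC subrr rpred0.
suff gpos x : 0 < g x -> g x + g (f - x) = 1.
  split=> // x; have := g0 x; rewrite le_eqVlt => /orP[/eqP gx0|];
    last exact: gpos.
  rewrite [LHS]addrC; have := gpos (f - x); rewrite subKr => -> //.
  by have := g1 x; rewrite -gx0 add0r; apply: lt_le_trans.
move=> gx; apply/eqP; rewrite eq_le g1 andbT leNgt; apply/negP => gx1.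
set d := g x + g (f - x) in gx1.
have d0 : 0 < d by apply: lt_trans gx1.
(* Dividing the single value g x by d keeps g valid: a feasible list through
   x has g-sum at least d, because without one copy of x it still has g-sum
   at least g (f - x); so it loses at most d - 1 unless its copies of x
   alone weigh d. *)
pose h r := if r == x then g x / d else g r.
suff hg : h = g.
  have : h x = g x by rewrite hg.
  rewrite /h eqxx => /(canRL (divfK (lt0r_neq0 d0))) /eqP.
  by rewrite -subr_eq0 -{1}[g x]mulr1 -mulrBr mulf_eq0 gt_eqF //= subr_eq0
    lt_eqF.
have hle r : h r <= g r.
  rewrite /h; case: eqP => // ->.
  by rewrite ler_pdivrMr // ler_peMr ?ltW.
apply: minimal_le => //; apply/validP; split=> [r|l lS].
  by rewrite /h; case: ifP => // _; rewrite divr_ge0 // ltW.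
have [xl|xl] := boolP (x \in l); last first.
  rewrite (_ : \sum_(r <- l) h r = \sum_(r <- l) g r); first exact: gv.
  rewrite big_seq [RHS]big_seq; apply: eq_bigr => r rl; rewrite /h.
  by case: eqP => // rx; rewrite -rx rl in xl.
pose c : R := (count_mem x l)%:R.
have hE : \sum_(r <- l) h r = \sum_(r <- l | r != x) g r + c * (g x / d).
  rewrite (bigID (pred1 x)) /= addrC; congr (_ + _).
    by apply: eq_bigr => r; rewrite /h => /negPf ->.
  rewrite (eq_bigr (fun=> g x / d)); last by move=> r /eqP ->; rewrite /h eqxx.
  by rewrite big_const_seq /= /c mulr_natl -Monoid.iteropE.
have gE : \sum_(r <- l) g r = \sum_(r <- l | r != x) g r + c * g x.
  rewrite (bigID (pred1 x)) /= addrC; congr (_ + _).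
  rewrite (eq_bigr (fun=> g x)); last by move=> r /eqP ->.
  by rewrite big_const_seq /= /c mulr_natl -Monoid.iteropE.
have rest0 : 0 <= \sum_(r <- l | r != x) g r by apply: sumr_ge0.
have gl : d <= \sum_(r <- l) g r.
  rewrite (big_rem x) //= /d lerD2l (le_trans _ (gsum _)) //.
  rewrite -(gper (f - x) (\sum_(r <- l) r - f)) //.
  by rewrite (big_rem x) //= !addrA subrK [f + _]addrC addrK.
rewrite hE; rewrite gE in gl.
have [cd|cd] := leP d (c * g x).
  by rewrite mulrA (le_trans (_ : 1 <= c * g x / d)) ?lerDr // ler_pdivlMr //
    mul1r.
have -> : c * (g x / d) = c * g x / d by rewrite mulrA.
set u := c * g x in gl cd *; set v := \sum_(r <- l | _) _ in gl rest0 *.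
rewrite -(ler_pM2r d0) mulrDl divfK ?mul1r ?lt0r_neq0 //.
have : 0 <= (d - 1) * (d - u) by rewrite mulr_ge0 // subr_ge0 ltW.
have := ler_wpM2l (ltW d0) gl; nra.
Qed.

Lemma tight_triple g h x y w :
    (tight_set S f g `<=` tight_set S f h)%classic ->
  x + y + w = f -> g x + g y + g w = 1 -> h x + h y + h w = 1.
Proof.
move=> /tight_set_sub gh xyw g1; have := gh [:: x; y; w].
rewrite /feasible_seq !big_cons !big_nil !addr0 !addrA xyw subrr rpred0 => ->
  //.
Qed.

(** The lists [:: x; f - x] and [:: f - s] are tight for a regular g, hence for
    h; this forces the symmetry of h and its vanishing on S, and subadditivity
    is then the validity of h at [:: x; y; f - (x + y)]. *)
Lemma tight_regular g h : regular g -> valid S f h ->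
  (tight_set S f g `<=` tight_set S f h)%classic -> regular h.
Proof.
move=> gR /validP[h0 hv] gh; have [g0 gS gD gf] := gR.
have hf x : h x + h (f - x) = 1.
  move/tight_set_sub : gh => /(_ [:: x; f - x]).
  rewrite /feasible_seq !big_cons !big_nil !addr0; apply; last exact: gf.
  by rewrite subrKC subrr rpred0.
have hS s : s \in S -> h s = 0.
  move=> sS; have := hf (f - s); rewrite subKr.
  have gs := regularD f gR sS; have gNs : - s \in S by rewrite rpredN.
  have gfs := regularD f gR gNs.
  have gf1 : g f = 1 by have := gf 0; rewrite subr0 gS ?rpred0 // add0r.
  move=> hs1; move/tight_set_sub : gh => /(_ [:: f - s]).
  rewrite /feasible_seq !big_cons !big_nil !addr0 addrC addrA addNr add0r => hs.
  by move: hs1; rewrite hs ?gfs //; lra.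
split=> // x y.
have := hv [:: x; y; f - (x + y)]; have := hf (x + y).
rewrite /feasible_seq !big_cons !big_nil !addr0 [x + (y + _)]addrA subrKC subrr.
by rewrite rpred0 => hxy /(_ isT); lra.
Qed.

(** Two numbers that are at least 1 and have mean 1 are both 1. *)
Lemma half_tight g g1 g2 : valid S f g1 -> valid S f g2 ->
    g = (fun r => 2^-1 * (g1 r + g2 r)) ->
  (tight_set S f g `<=` tight_set S f g1)%classic.
Proof.
move=> /validP[_ g1v] /validP[_ g2v] ->; apply/tight_set_sub => l lS.
rewrite -mulr_sumr big_split /=; have := g1v _ lS; have := g2v _ lS; lra.
Qed.

Lemma facet_extreme g : facet S f g -> extreme S f g.
Proof.
move=> [gv gF]; split=> // g1 g2 g1v g2v gE; split; apply/esym/gF => //.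
  exact: half_tight gE.
apply: half_tight g1v _ => //; rewrite gE; apply/funext => r.
by rewrite addrC.
Qed.

(** One factor e makes all the finitely many perturbations e * u.2 smaller than
    the corresponding slacks u.1. *)
Lemma common_scale (s : seq (R * R)) :
    (forall u, u \in s -> 0 <= u.1 /\ (u.1 = 0 -> u.2 = 0)) ->
  exists2 e : R, 0 < e & forall u, u \in s -> e * `|u.2| <= u.1.
Proof.
elim: s => [|u s IH] us; first by exists 1.
have [v vs|e e0 es] := IH; first by apply: us; rewrite inE vs orbT.
have [u0 uz] := us u (mem_head _ _).
have [u1|u1] := eqVneq u.1 0.
  exists e => // v; rewrite inE => /orP[/eqP ->|/es //].
  by rewrite u1 uz // normr0 mulr0.
have a0 : 0 < `|u.2| + 1 by rewrite ltr_wpDl.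
have u1p : 0 < u.1 by rewrite lt_neqAle eq_sym u1.
exists (Num.min e (u.1 / (`|u.2| + 1))).
  by rewrite lt_min e0 divr_gt0.
move=> v; rewrite inE => /orP[/eqP ->|/es ev].
  apply: (@le_trans _ _ (u.1 / (`|u.2| + 1) * `|u.2|)).
    by rewrite ler_wpM2r // ge_min lexx orbT.
  by rewrite mulrAC ler_pdivrMr // ler_wpM2l // lerDl.
by apply: le_trans ev; rewrite ler_wpM2r // ge_min lexx.
Qed.

(** When S has finite index, tight triples are the only obstruction to a
    perturbation: for small e both g + e k and g - e k are regular, and g is
    their midpoint.  Nonnegativity comes for free, because a subadditive
    function that vanishes on S cannot be negative on an element of finite
    order modulo S. *)
Lemma extreme_no_perturbation g (k : G -> R) (N : nat) (reps : seq G) :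
    regular g -> extreme S f g -> (0 < N)%N -> (forall x, x *+ N \in S) ->
    (forall x, exists2 r, r \in reps & x - r \in S) ->
    (forall s, s \in S -> k s = 0) ->
    (forall x s, s \in S -> k (x + s) = k x) ->
    (forall x y w, x + y + w = f -> g x + g y + g w = 1 ->
      k x + k y + k w = 0) ->
  forall x, k x = 0.
Proof.
move=> gR gE N0 NS repsP kS kper ktight; have [g0 gS gD gf] := gR.
pose slack x y := (g x + g y + g (f - x - y) - 1, k x + k y + k (f - x - y)).
have xyf x y : x + y + (f - x - y) = f by rewrite -(addrA f) -opprD subrKC.
have slack_per x y s t : s \in S -> t \in S ->
  slack (x + s) (y + t) = slack x y.
  move=> sS tS; rewrite /slack (regularD x gR sS) (regularD y gR tS) (kper x s)
    // (kper y t) //.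
  have -> : f - (x + s) - (y + t) = f - x - y + (- s - t).
    by rewrite !opprD !addrA (addrAC _ (- s) (- y)).
  have stS : - s - t \in S by rewrite rpredB ?rpredN.
  by rewrite (regularD _ gR stS) kper.
have [u|e e0 eP] := @common_scale [seq slack x y | x <- reps, y <- reps].
  move=> /allpairsP[[x y] /= [_ _ ->]] /=; split.
    by rewrite subr_ge0; apply: regular_triple.
  by move=> /eqP; rewrite subr_eq0 => /eqP; exact: ktight.
have kE x y w : x + y + w = f ->
    e * `|k x + k y + k w| <= g x + g y + g w - 1.
  move=> xyw; have wE : w = f - x - y.
    by rewrite -xyw -(addrA (x + y + w)) -opprD [RHS]addrC addKr.
  have [x' x'r xS] := repsP x; have [y' y'r yS] := repsP y.
  have sl : slack x y = slack x' y'.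
    by rewrite -(slack_per x' y' (x - x') (y - y')) // !subrKC.
  have := eP (slack x y); rewrite {1}sl allpairs_f // => /(_ isT).
  by rewrite /slack /= -wE.
have pertR (c : R) : `|c| <= e -> regular (fun r => g r + c * k r).
  move=> ce.
  have hf x : g x + c * k x + (g (f - x) + c * k (f - x)) = 1.
    have := ktight x (f - x) 0; rewrite addr0 subrKC (gS 0) ?rpred0 // gf addr0.
    rewrite (kS 0) ?rpred0 // addr0 => /(_ erefl erefl) kx.
    by rewrite addrACA gf -mulrDr kx mulr0 addr0.
  have hS s : s \in S -> g s + c * k s = 0.
    by move=> sS; rewrite gS // kS // mulr0 addr0.
  have hD x y : g (x + y) + c * k (x + y) <=
      g x + c * k x + (g y + c * k y).
    have := kE x y (f - (x + y)); rewrite subrKC => /(_ erefl).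
    move: (hf (x + y)); set w := f - (x + y) => hw kxy.
    have : - (e * `|k x + k y + k w|) <= c * (k x + k y + k w).
      rewrite lerNl -mulrN; apply: le_trans (ler_norm _) _.
      by rewrite normrM normrN ler_wpM2r.
    lra.
  split=> // x; rewrite -(@pmulrn_lge0 _ _ N) //.
  rewrite -(hS (x *+ N) (NS x)).
  elim: N {N0 NS} => [|n IH]; first by rewrite !mulr0n hS ?rpred0.
  by rewrite !mulrS (le_trans (hD _ _)) // lerD2l.
have [//|//||gE1 _] := gE.2 (fun r => g r + e * k r) (fun r => g r + (- e) * k
  r).
- by apply/regular_valid/pertR; rewrite gtr0_norm.
- by apply/regular_valid/pertR; rewrite normrN gtr0_norm.
- by apply/funext => r; lra.
move=> x; have := congr1 (fun h => h x) gE1 => /= /eqP.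
by rewrite -subr_eq0 opprD addrA subrr add0r oppr_eq0 mulf_eq0 gt_eqF //= =>
  /eqP.
Qed.

End GroupTheory.

(** * Cells of the triangulation in zero-sum coordinates *)

Section Ord3.

(** The three coordinates play symmetric roles.  Writing them as distinct
    indices i, j, k treats all their permutations at once. *)
Lemma ord3_third (i j : 'I_3) : i != j -> exists k, uniq [:: i; j; k].
Proof.
move=> ij; have [k] : exists k : 'I_3, k \notin [:: i; j].
  apply/existsP; rewrite -negb_forall; apply/negP => /forallP kij.
  have : (#|'I_3| <= #|[:: i; j]|)%N by apply: subset_leq_card;
    apply/fintype.subsetP => k _; exact: kij.
  by move=> /leq_trans/(_ (card_size _)); rewrite card_ord.
rewrite !inE negb_or => /andP[ki kj]; exists k.
by rewrite /= !inE negb_or ij (eq_sym i) (eq_sym j) ki kj.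
Qed.

Lemma ord3_others (i : 'I_3) : exists j k, uniq [:: i; j; k].
Proof.
have [j ij] : exists j : 'I_3, i != j.
  by exists (if i == 0 then 1 else 0); case: (eqVneq i 0) => [->|].
by exists j; exact: ord3_third.
Qed.

Section Three.
Variables (i j k : 'I_3) (ijk : uniq [:: i; j; k]).

Lemma ord3_mem l : l \in [:: i; j; k].
Proof.
have := uniq_leq_size ijk; move: (ijk) => /card_uniqP /= c3.
have /subset_cardP : #|[:: i; j; k]| = #|'I_3| by rewrite c3 card_ord.
by move=> /(_ (subset_predT _)) ->.
Qed.

Lemma ord3P (P : 'I_3 -> Prop) : P i -> P j -> P k -> forall l, P l.
Proof.
by move=> Pi Pj Pk l; have := ord3_mem l; rewrite !inE => /or3P[] /eqP ->.
Qed.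

Lemma sum3 (V : nmodType) (F : 'I_3 -> V) :
  \sum_l F l = F i + F j + F k.
Proof.
rewrite -big_enum /= (perm_big [:: i; j; k]); last first.
  apply: uniq_perm => //; first exact: enum_uniq.
  by move=> l; rewrite mem_enum ord3_mem.
by rewrite !big_cons big_nil /= addr0 addrA.
Qed.

End Three.
End Ord3.

Section Cells.
Variable R : realType.
Implicit Types (a b k : R) (x y s n : 'rV[R]_3) (h : 'rV[R]_3 -> R).

Lemma int_lt_addr1 k a : k \is a Num.int -> a \is a Num.int ->
  (k < a + 1) = (k <= a).
Proof.
by move=> /intrP[m ->] /intrP[n ->]; rewrite -(intrD _ n 1) ltr_int ler_int
  ltzD1.
Qed.

Lemma int_floor a : exists k, [/\ k \is a Num.int, k <= a & a < k + 1].
Proof.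
exists (Num.floor a)%:~R; split; rewrite ?intr_int ?floor_le //.
by rewrite -(intrD _ _ 1) floorD1_gt.
Qed.

(** The closed cell of the real line that contains a in its relative interior,
    an integer or a unit interval, described by its supporting inequalities
    rather than by floors and ceilings. *)
Definition same_cell a b := forall k, k \is a Num.int ->
  (k <= a -> k <= b) /\ (a <= k -> b <= k).

Lemma same_cell_refl a : same_cell a a.
Proof. by []. Qed.

Lemma same_cell_trans a b c : same_cell a b -> same_cell b c -> same_cell a c.
Proof.
move=> ab bc k ki; have [ab1 ab2] := ab k ki; have [bc1 bc2] := bc k ki.
by split=> [/ab1|/ab2].
Qed.

Lemma same_cell_int a b : a \is a Num.int -> same_cell a b -> b = a.
Proof.
move=> ai /(_ a ai)[ab ba]; apply/eqP.
by rewrite eq_le ab // ba.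
Qed.

Lemma same_cell_open k a b : k \is a Num.int ->
  k < a -> a < k + 1 -> k <= b -> b <= k + 1 -> same_cell a b.
Proof.
move=> ki ka ak kb bk l li; split=> [la|al].
  by apply: le_trans kb; rewrite -int_lt_addr1 // (le_lt_trans la).
apply: (le_trans bk); rewrite leNgt int_lt_addr1 // -ltNge.
exact: lt_le_trans al.
Qed.

Lemma same_cellN a b : same_cell a b -> same_cell (- a) (- b).
Proof.
move=> ab k ki; have [] := ab (- k); rewrite ?rpredN //.
by rewrite lerNl (lerNr a) (lerNl b) (lerNr b) => ab1 ab2; split.
Qed.

Lemma same_cellDl k a b : k \is a Num.int -> same_cell a b ->
  same_cell (k + a) (k + b).
Proof.
move=> ki ab l li; have [] := ab (l - k); rewrite ?rpredB //.
by rewrite !lerBlDl !lerBrDl.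
Qed.

(** The plane as the zero-sum triples: the third coordinate - x1 - x2 turns the
    lines x1 + x2 = b into coordinate lines. *)
Definition plane x := \sum_i x 0 i = 0.
Definition cell x y := forall i, same_cell (x 0 i) (y 0 i).
Definition integral x := forall i, x 0 i \is a Num.int.
Definition simplex s := (forall i, 0 <= s 0 i) /\ \sum_i s 0 i = 1.
Definition vertex (i : 'I_3) : 'rV[R]_3 := delta_mx 0 i.

(** A triangle is n + e * simplex with n integral; e = 1 gives one of the two
    orientations and e = -1 the other. *)
Definition sign (e : R) := e = 1 \/ e = -1.

Lemma vertexE (i l : 'I_3) : vertex i 0 l = (l == i)%:R.
Proof. by rewrite mxE eqxx. Qed.

Lemma simplex_vertex (i : 'I_3) : simplex (vertex i).
Proof.
split=> [l|]; first by rewrite vertexE ler0n.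
rewrite (bigD1 i) //= vertexE eqxx big1 ?addr0 // => l /negPf li.
by rewrite vertexE li.
Qed.

Lemma simplex_sum (i j k : 'I_3) s : uniq [:: i; j; k] -> simplex s ->
  s 0 i + s 0 j + s 0 k = 1.
Proof. by move=> u [_]; rewrite (sum3 u). Qed.

Lemma plane_sum (i j k : 'I_3) x : uniq [:: i; j; k] -> plane x ->
  x 0 i + x 0 j + x 0 k = 0.
Proof. by rewrite /plane => u; rewrite (sum3 u). Qed.

Lemma simplex_le1 s i : simplex s -> s 0 i <= 1.
Proof.
move=> sS; have [j [k u]] := ord3_others i.
have := simplex_sum u sS; have := sS.1 j; have := sS.1 k; lra.
Qed.

Lemma planeD x y : plane x -> plane y -> plane (x + y).
Proof.
rewrite /plane => x0 y0; under eq_bigr do rewrite mxE.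
by rewrite big_split /= x0 y0 addr0.
Qed.

Lemma planeZ a x : plane x -> plane (a *: x).
Proof.
rewrite /plane => x0; under eq_bigr do rewrite mxE.
by rewrite -mulr_sumr x0 mulr0.
Qed.

Lemma planeN x : plane x -> plane (- x).
Proof. by rewrite -scaleN1r; exact: planeZ. Qed.

Lemma planeB x y : plane x -> plane y -> plane (x - y).
Proof. by move=> x0 y0; apply: planeD => //; apply: planeN. Qed.

Lemma integralD x y : integral x -> integral y -> integral (x + y).
Proof. by move=> xi yi i; rewrite mxE rpredD. Qed.

Lemma integralN x : integral x -> integral (- x).
Proof. by move=> xi i; rewrite mxE rpredN. Qed.

Lemma integralB x y : integral x -> integral y -> integral (x - y).
Proof. by move=> xi yi; apply: integralD => //; apply: integralN. Qed.

(** The fractional parts of a zero-sum triple have sum 0, 1 or 2: then x is a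
    vertex, or its cell lies in a triangle n + simplex with n the floor of x,
    or in n - simplex with n the floor plus 1. *)
Lemma plane_triangle x : plane x -> exists e n,
  [/\ sign e, integral n, \sum_i n 0 i = - e &
    forall y, plane y -> cell x y -> simplex (e *: (y - n))].
Proof.
move=> x0.
have [k kP] := choice (fun i : 'I_3 => int_floor (x 0 i)).
have ki i : k i \is a Num.int by case: (kP i).
have kx i : k i <= x 0 i by case: (kP i).
have xk i : x 0 i < k i + 1 by case: (kP i).
have [i [j u]] := ord3_others 0.
have sum_k : k 0 + k i + k j \is a Num.int by rewrite !rpredD.
have xs := plane_sum u x0.
have y_ge y l : cell x y -> k l <= y 0 l.
  by move=> /(_ l (k l) (ki l))[+ _]; apply.
have y_le y l : cell x y -> y 0 l <= k l + 1.
  move=> /(_ l (k l + 1))[|_]; first by rewrite rpredD ?rpred1.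
  by apply; exact: ltW.
have int_cases : [\/ k 0 + k i + k j = 0, k 0 + k i + k j = -1 |
    k 0 + k i + k j = -2].
  have c0 : k 0 + k i + k j <= 0.
    by have := kx 0; have := kx i; have := kx j; lra.
  have c3 : - 3 < k 0 + k i + k j.
    by have := xk 0; have := xk i; have := xk j; lra.
  move: sum_k c0 c3; set c := k 0 + _ + _ => /intrP[m ->].
  rewrite -[- 3]/((- 3)%:~R) ltr_int -[0]/(0%:~R) ler_int => m0 m3.
  have : [\/ m = 0, m = -1 | m = -2].
    by case: m m0 m3 => [[|m]|[|[|[|m]]]] // _ _;
      [apply: Or31 | apply: Or32 | apply: Or33].
  by case=> ->; [apply: Or31 | apply: Or32 | apply: Or33].
case: int_cases => ksum.
- have xE l : x 0 l = k l.
    apply/eqP; rewrite eq_le kx andbT; move: l.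
    have := kx 0; have := kx i; have := kx j; move=> kj k2 k0.
    by apply: (ord3P u); lra.
  exists 1, (x - vertex 0); split; first by left.
  + by move=> l; rewrite !mxE xE rpredB ?ki ?rpred_nat.
  + under eq_bigr do rewrite mxE [X in _ + X]mxE.
    by rewrite big_split sumrN /= x0 (simplex_vertex 0).2 sub0r.
  move=> y y0 xy; have -> : y = x.
    apply/rowP => l; apply: same_cell_int; [by rewrite xE|exact: xy].
  by rewrite opprB addrC subrK scale1r; exact: simplex_vertex.
- exists 1, (\row_l k l); split; first by left.
  + by move=> l; rewrite mxE.
  + by rewrite (sum3 u) !mxE.
  move=> y y0 xy; rewrite scale1r; split=> [l|].
    by rewrite !mxE subr_ge0 y_ge.
  by have := plane_sum u y0; rewrite (sum3 u) !mxE; move: ksum; lra.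
- exists (-1), (\row_l (k l + 1)); split; first by right.
  + by move=> l; rewrite mxE rpredD ?rpred1.
  + by rewrite (sum3 u) !mxE; move: ksum; lra.
  move=> y y0 xy; rewrite scaleN1r; split=> [l|].
    by rewrite !mxE opprB subr_ge0 y_le.
  by have := plane_sum u y0; rewrite (sum3 u) !mxE; move: ksum; lra.
Qed.

Definition cellwise_affine h := forall x, plane x -> exists (c : 'I_3 -> R) b,
  forall y, plane y -> cell x y -> h y = \sum_i c i * y 0 i + b.

End Cells.

(** * Rounding 3 x 3 flows *)

Section Rounding.
Variable R : realType.
Implicit Types (M D : 'M[R]_3) (x y : 'rV[R]_3).

(** In K_{3,3}, a nonempty subgraph without vertices of degree one contains a
    cycle, of length 4 or 6; alternating signs along it give D.  Starting from
    two edges at i0, either two of the rows met share a second column, or the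
    three rows and columns form a hexagon. *)
Lemma cycle_direction (b : 'I_3 -> 'I_3 -> bool) i0 j0 : b i0 j0 ->
    (forall i j, b i j -> exists2 j', j' != j & b i j') ->
    (forall i j, b i j -> exists2 i', i' != i & b i' j) ->
  exists D, [/\ forall i j, D i j \in [:: 0; 1; -1],
    forall i j, D i j != 0 -> b i j, exists i j, D i j != 0,
    forall i, \sum_j D i j = 0 & forall j, \sum_i D i j = 0].
Proof.
pose col (j : 'I_3) i i' : 'M[R]_3 := delta_mx i j - delta_mx i' j.
have colE j i i' k l : col j i i' k l =
    ((k == i) && (l == j))%:R - ((k == i') && (l == j))%:R by rewrite !mxE.
have sum_delta (T : finType) (i : T) : \sum_k (k == i)%:R = 1 :> R.
  by rewrite (bigD1 i) //= eqxx big1 ?addr0 // => k /negPf ->.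
have colC j i i' l : \sum_k col j i i' k l = 0.
  under eq_bigr do rewrite colE.
  case: (l == j); last by rewrite big1 // => k _; rewrite !andbF subrr.
  by under eq_bigr do rewrite !andbT; rewrite sumrB !sum_delta subrr.
have colR j i i' k : \sum_l col j i i' k l = (k == i)%:R - (k == i')%:R.
  rewrite (bigD1 j) //= colE !eqxx !andbT big1 ?addr0 // => l /negPf lj.
  by rewrite colE lj !andbF subrr.
have sq i i' j j' : i != i' -> j != j' -> b i j -> b i' j -> b i j' ->
  b i' j' ->
    exists D, [/\ forall i j, D i j \in [:: 0; 1; -1],
    forall i j, D i j != 0 -> b i j, exists i j, D i j != 0,
    forall i, \sum_j D i j = 0 & forall j, \sum_i D i j = 0].
  move=> ii' jj' b1 b2 b3 b4; exists (col j i i' + col j' i' i).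
  have DE k l : (col j i i' + col j' i' i) k l = 
     ((k == i) && (l == j))%:R - ((k == i') && (l == j))%:R +
     (((k == i') && (l == j'))%:R - ((k == i) && (l == j'))%:R).
    by rewrite mxE !colE.
  split.
  - move=> k l; rewrite DE; case: (eqVneq k i) => [->|ki].
      rewrite (negPf ii') /=; case: (eqVneq l j) => [->|lj].
        by rewrite (negPf jj') /= !inE !(subr0, addr0) eqxx orbT.
      by case: (l == j'); rewrite /= !(subr0, sub0r, add0r) !inE eqxx ?orbT.
    case: (k == i') => /=; last by rewrite !subr0 addr0 inE eqxx.
    case: (eqVneq l j) => [->|lj].
      by rewrite (negPf jj') /= !inE !(subr0, addr0, sub0r) eqxx !orbT.
    by case: (l == j'); rewrite /= !(subr0, sub0r, add0r) !inE eqxx ?orbT.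
  - move=> k l; rewrite DE; case: (eqVneq k i) => [->|ki]; last first.
      case: (eqVneq k i') => [->|ki']; last by rewrite /= !subr0 addr0 eqxx.
      case: (eqVneq l j) => [->//|_].
      by case: (eqVneq l j') => [->//|_]; rewrite /= !subr0 addr0 eqxx.
    case: (eqVneq l j) => [->//|_].
    by case: (eqVneq l j') => [->//|_]; rewrite /= !andbF !subr0 addr0 eqxx.
  - exists i, j; rewrite DE !eqxx (negPf ii') (negPf jj') /=.
    by rewrite !subr0 addr0 oner_neq0.
  - move=> k; under eq_bigr do rewrite mxE.
    by rewrite big_split /= !colR; ring.
  - move=> l; under eq_bigr do rewrite mxE.
    by rewrite big_split /= !colC addr0.
move=> b00 brow bcol.
have [j1 j10 b01] := brow _ _ b00.
have [i1 i10 b10] := bcol _ _ b00.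
have [i2 i20 b21] := bcol _ _ b01.
rewrite eq_sym in i10; rewrite eq_sym in j10; rewrite eq_sym in i20.
have [i12|i12] := eqVneq i1 i2.
  by subst i2; apply: (sq i0 i1 j0 j1).
have ui : uniq [:: i0; i1; i2] by rewrite /= !inE negb_or i10 i20 i12.
have [j2 uj] := ord3_third j10.
have [k1 k10 b1k] := brow _ _ b10.
have [|k11] := eqVneq k1 j1; first by move=> k11; subst k1;
  apply: (sq i0 i1 j0 j1).
have k1E : k1 = j2.
  by have := ord3_mem uj k1; rewrite !inE (negPf k10) (negPf k11) => /eqP.
subst k1.
have [k2 k21 b2k] := brow _ _ b21.
have [|k20] := eqVneq k2 j0; first by move=> k20; subst k2;
  apply: (sq i0 i2 j0 j1).
have k2E : k2 = j2.
  by have := ord3_mem uj k2; rewrite !inE (negPf k20) (negPf k21) => /eqP.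
subst k2.
pose D := col j0 i0 i1 + col j1 i2 i0 + col j2 i1 i2.
have DE k l : D k l = 
  (((k == i0) && (l == j0))%:R - ((k == i1) && (l == j0))%:R) +
  (((k == i2) && (l == j1))%:R - ((k == i0) && (l == j1))%:R) +
  (((k == i1) && (l == j2))%:R - ((k == i2) && (l == j2))%:R).
  by rewrite /D 2!mxE !colE.
have [e01 e02 e12] : [/\ (i0 == i1) = false,
  (i0 == i2) = false & (i1 == i2) = false].
  by rewrite (negPf i10) (negPf i20) (negPf i12).
have [f01 f02 f12] : [/\ (j0 == j1) = false,
  (j0 == j2) = false & (j1 == j2) = false].
  by move: uj; rewrite /= !inE negb_or => /and3P[/andP[/negPf->
    /negPf->] /negPf->].
have eqs := (eqxx, e01, e02, e12, f01, f02, f12, eq_sym i1 i0, eq_sym i2 i0,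
  eq_sym i2 i1, eq_sym j1 j0, eq_sym j2 j0, eq_sym j2 j1).
exists D; split.
- apply: (ord3P ui); apply: (ord3P uj); rewrite DE !eqs /=;
  by rewrite !(subr0, add0r, addr0, sub0r) !inE eqxx ?orbT.
- apply: (ord3P ui); apply: (ord3P uj); rewrite DE !eqs /= ?b00 ?b01 ?b10 ?b21
  ?b1k ?b2k //;
  by rewrite !(subr0, add0r, addr0, sub0r) eqxx.
- by exists i0, j0; rewrite DE !eqs /= !(subr0, addr0) oner_neq0.
- move=> k; under eq_bigr do rewrite 2!mxE.
  by rewrite !big_split /= !colR; ring.
- move=> l; under eq_bigr do rewrite 2!mxE.
  by rewrite !big_split /= !colC !addr0.
Qed.

(** The largest step for which no entry leaves its unit interval makes an entry
    integral. *)
Lemma push_to_integer M D :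
    (forall i j, D i j \in [:: 0; 1; -1]) ->
    (forall i j, D i j != 0 -> M i j \isn't a Num.int) ->
    (exists i j, D i j != 0) ->
  exists t, [/\ 0 < t, forall i j, same_cell (M i j) (M i j + t * D i j) &
    exists i j, M i j \isn't a Num.int /\ M i j + t * D i j \is a Num.int].
Proof.
move=> D01 DM [i0 [j0 D0]].
have [k kP] := choice (fun p : 'I_3 * 'I_3 => int_floor (M p.1 p.2)).
pose room p := if D p.1 p.2 == 1 then k p + 1 - M p.1 p.2 else M p.1 p.2 - k p.
case: (@arg_minP _ _ _ (i0, j0) (fun p => D p.1 p.2 != 0) room D0) => -[i j] /=
  Dij tmin.
have kint p : k p \is a Num.int by case: (kP p).
have room_gt0 p : D p.1 p.2 != 0 -> 0 < room p.
  move=> /DM Mp; have [_ kM Mk] := kP p; rewrite /room; case: ifP => _.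
    by rewrite subr_gt0.
  rewrite subr_gt0 lt_neqAle kM andbT; apply: contra Mp => /eqP <-.
  exact: kint.
exists (room (i, j)); split; first exact: room_gt0.
- move=> a b; have [->|Dab] := eqVneq (D a b) 0.
    by rewrite mulr0 addr0.
  have := tmin (a, b) Dab; have := room_gt0 (i, j) Dij.
  have [_ kM Mk] := kP (a, b).
  have kM' : k (a, b) < M a b.
    rewrite lt_neqAle kM andbT; apply: contra (DM _ _ Dab) => /eqP <-.
    exact: kint.
  set t := room (i, j); rewrite /room /=.
  have := D01 a b; rewrite !inE (negPf Dab) /=.
  move=> /orP[] /eqP ->; rewrite ?eqxx => t0 tle.
    by apply: (@same_cell_open _ (k (a, b))) => //=; lra.
  move: tle; rewrite (_ : (-1 == 1 :> R) = false); last by apply/negP => /eqP;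
    lra.
  by move=> tle; apply: (@same_cell_open _ (k (a, b))) => //=; lra.
- exists i, j; split; first exact: DM.
  have := D01 i j; rewrite !inE (negPf Dij) /room /= => /orP[] /eqP ->.
    rewrite eqxx mulr1 subrKC rpredD ?rpred1 //; exact: kint.
  rewrite (_ : (-1 == 1 :> R) = false); last by apply/negP => /eqP; lra.
  by rewrite mulrN1 subKr; exact: kint.
Qed.

(** Induction on the number of nonintegral entries.  The sum is affine along a
    cycle direction D, so it does not increase along D or along - D; walk that
    way until a further entry is integral. *)
Lemma round_matrix (H : 'I_3 -> 'rV[R]_3 -> R) (c : R) M :
    (forall r, cellwise_affine (H r)) -> (forall r, plane (row r M)) ->
    (forall j, \sum_r M r j \is a Num.int) ->
    (forall M', (forall r, integral (row r M')) ->
      (forall r, cell (row r M) (row r M')) ->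
      (forall r, plane (row r M')) ->
      (forall j, \sum_r M' r j = \sum_r M r j) -> c <= \sum_r H r (row r M')) ->
  c <= \sum_r H r (row r M).
Proof.
move=> Haff.
pose frac M := [set p : 'I_3 * 'I_3 | M p.1 p.2 \isn't a Num.int].
move: {2}#|frac M|.+1 (ltnSn #|frac M|) => N.
elim: N M => // N IH M; rewrite ltnS => MN Mrow Mcol Hint.
have [[p pfrac]|/forallNP nofrac] := pselect (exists p,
  M p.1 p.2 \isn't a Num.int); last first.
  apply: Hint => // r j; rewrite mxE; apply: contrapT => /negP rj.
  exact: (nofrac (r, j)).
have plane_row r : \sum_j M r j = 0.
  by have := Mrow r; rewrite /plane; under eq_bigr do rewrite mxE.
have [||D [D01 DM D0 Drow Dcol]] :=
    @cycle_direction (fun i j => M i j \isn't a Num.int) p.1 p.2 pfrac.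
- move=> i j Mij; apply: contrapT => nj; case/negP: Mij.
  have /eqP := plane_row i; rewrite (bigD1 j) //= addrC addr_eq0 => /eqP Mj.
  rewrite -[M i j]opprK -Mj rpredN rpred_sum // => j' j'j.
  by apply: contrapT => /negP Mj'; apply: nj; exists j'.
- move=> i j Mij; apply: contrapT => ni; case/negP: Mij.
  have := Mcol j; rewrite (bigD1 i) //= addrC rpredDl //.
  apply: rpred_sum => i' i'i.
  by apply: contrapT => /negP Mi'; apply: ni; exists i'.
have [lc lcP] := choice (fun r => Haff r _ (Mrow r)).
have [lb lbP] := choice lcP.
pose slope (D : 'M_3) := \sum_r \sum_i lc r i * D r i.
wlog sl : D D01 DM D0 Drow Dcol / slope D <= 0.
  move=> W; have [|sl] := leP (slope D) 0; first exact: W.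
  apply: (W (- D)).
  - move=> i j; have := D01 i j; rewrite !inE mxE => /or3P[] /eqP ->;
    by rewrite ?oppr0 ?opprK eqxx ?orbT.
  - by move=> i j; rewrite mxE oppr_eq0; exact: DM.
  - by have [i [j Dij]] := D0; exists i, j; rewrite mxE oppr_eq0.
  - by move=> i; under eq_bigr do rewrite mxE; rewrite sumrN Drow oppr0.
  - by move=> i; under eq_bigr do rewrite mxE; rewrite sumrN Dcol oppr0.
  rewrite /slope; under eq_bigr do under eq_bigr do rewrite mxE mulrN.
  by under eq_bigr do rewrite sumrN; rewrite sumrN oppr_le0 ltW.
have [t [t0 tcell [i [j [Mij Mtij]]]]] := push_to_integer D01 DM D0.
pose M1 := M + t *: D.
have M1E a b : M1 a b = M a b + t * D a b by rewrite !mxE.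
have M1row r : plane (row r M1).
  rewrite /plane; under eq_bigr do rewrite mxE M1E.
  by rewrite big_split /= plane_row -mulr_sumr Drow mulr0 addr0.
have M1col b : \sum_r M1 r b = \sum_r M r b.
  under eq_bigr do rewrite M1E.
  by rewrite big_split /= -mulr_sumr Dcol mulr0 addr0.
have M1cell r : cell (row r M) (row r M1).
  by move=> b; rewrite ![row r _ 0 b]mxE M1E; exact: tcell.
have M1c : c <= \sum_r H r (row r M1).
  apply: IH => // [|b|M' M'int M'cell M'row M'col].
  - apply: leq_trans MN; apply/proper_card/properP; split.
      apply/fintype.subsetP => -[a b]; rewrite !inE /=; apply: contra => Mab.
      by have := same_cell_int Mab (tcell a b); rewrite M1E => ->.
    by exists (i, j); rewrite !inE //= M1E Mtij.
  - by rewrite M1col.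
  - apply: Hint => // [r b|b]; last by rewrite M'col.
    exact: same_cell_trans (M1cell r b) (M'cell r b).
apply: le_trans M1c _.
have -> : \sum_r H r (row r M1) = \sum_r H r (row r M) + t * slope D.
  rewrite /slope mulr_sumr -big_split /=; apply: eq_bigr => r _.
  rewrite (lbP r _ (M1row r) (M1cell r)) (lbP r _ (Mrow r)); last by move=> ?.
  rewrite mulr_sumr addrAC -big_split /=; congr (_ + _); apply: eq_bigr => b _.
  by rewrite ![row r _ 0 b]mxE M1E; ring.
by rewrite gerDl pmulr_rle0.
Qed.

End Rounding.

Section CellwiseAffine.
Variable R : realType.
Implicit Types (x y w n s F : 'rV[R]_3) (h : 'rV[R]_3 -> R).

Lemma cellwise_affine0 : cellwise_affine (fun=> 0 : R).
Proof.
move=> x _; exists (fun=> 0), 0 => y _ _.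
by rewrite big1 ?addr0 // => i _; rewrite mul0r.
Qed.

Lemma cellwise_affineD h1 h2 : cellwise_affine h1 -> cellwise_affine h2 ->
  cellwise_affine (fun x => h1 x + h2 x).
Proof.
move=> h1a h2a x x0; have [c1 [b1 E1]] := h1a x x0;
  have [c2 [b2 E2]] := h2a x x0.
exists (fun i => c1 i + c2 i), (b1 + b2) => y y0 xy; rewrite E1 // E2 //.
by under [in RHS]eq_bigr do rewrite mulrDl; rewrite big_split addrACA.
Qed.

Lemma cellwise_affineZ a h : cellwise_affine h ->
  cellwise_affine (fun x => a * h x).
Proof.
move=> ha x x0; have [c [b E]] := ha x x0.
exists (fun i => a * c i), (a * b) => y y0 xy; rewrite E // mulrDr mulr_sumr.
by under [in RHS]eq_bigr do rewrite -mulrA.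
Qed.

Lemma cellwise_affine_refine (m : nat) h : (0 < m)%N -> cellwise_affine h ->
  cellwise_affine (fun x => h (m%:R^-1 *: x)).
Proof.
move=> m0 ha x x0; have [c [b E]] := ha _ (planeZ m%:R^-1 x0).
have mR : 0 < m%:R :> R by rewrite ltr0n.
exists (fun i => c i / m%:R), b => y y0 xy; rewrite E; last 2 first.
- exact: planeZ.
- move=> i k ki; have [] := xy i (m%:R * k); first by rewrite rpredM ?rpred_nat.
  rewrite !mxE !ler_pdivlMl // !ler_pdivrMl //; split=> //.
by congr (_ + _); apply: eq_bigr => i _; rewrite mxE mulrA.
Qed.

Lemma uniq3 : uniq [:: 0; 1; ord_max : 'I_3]. Proof. by []. Qed.

Lemma round_triple h1 h2 h3 (c : R) x y w :
    cellwise_affine h1 -> cellwise_affine h2 -> cellwise_affine h3 ->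
    plane x -> plane y -> plane w -> integral (x + y + w) ->
    (forall x' y' w', integral x' -> integral y' -> integral w' ->
      plane x' -> plane y' -> plane w' -> cell w w' ->
      x' + y' + w' = x + y + w -> c <= h1 x' + h2 y' + h3 w') ->
  c <= h1 x + h2 y + h3 w.
Proof.
move=> a1 a2 a3 x0 y0 w0 xyw Hint.
pose sel (T : Type) (t1 t2 t3 : T) (r : 'I_3) :=
  if r == 0 then t1 else if r == 1 then t2 else t3.
pose M := \matrix_(r, j) sel _ x y w r 0 j.
have rowM r : row r M = sel _ x y w r.
  by apply/rowP => j; rewrite !mxE.
have := @round_matrix R (sel _ h1 h2 h3) c M.
rewrite (sum3 uniq3) !rowM; apply.
- by apply: (ord3P uniq3).
- by apply: (ord3P uniq3); rewrite rowM.
- by move=> j; rewrite (sum3 uniq3) !mxE; have := xyw j; rewrite !mxE.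
move=> M' M'int M'cell M'plane M'col; rewrite (sum3 uniq3).
apply: Hint => //.
  by have := M'cell ord_max; rewrite rowM.
apply/rowP => j; have := M'col j; rewrite !(sum3 uniq3) !mxE //.
Qed.

End CellwiseAffine.

(** * Barycentric coordinates and interpolation *)

Section Interpolation.
Variable R : realType.
Implicit Types (e : R) (x y n s : 'rV[R]_3) (g : 'rV[R]_3 -> R).

Definition barycentric x e n s :=
  [/\ sign e, integral n, simplex s & x = n + e *: s].

Definition vertex_average g e n s := \sum_i s 0 i * g (n + e *: vertex R i).

Lemma barycentric_cell x : plane x -> exists e n, [/\ sign e, integral n &
  forall y, plane y -> cell x y -> barycentric y e n (e *: (y - n))].
Proof.
move=> /plane_triangle[e [n [eS ni _ H]]]; exists e, n; split=> // y y0 xy.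
split=> //; first exact: H.
rewrite scalerA (_ : e * e = 1) ?scale1r ?subrKC //.
by case: eS => ->; rewrite ?mulrNN mulr1.
Qed.

Lemma sign_mulK e : sign e -> e * e = 1.
Proof. by case=> ->; rewrite ?mulrNN mulr1. Qed.

Lemma int_small (a : R) : a \is a Num.int -> -1 < a -> a < 1 -> a = 0.
Proof.
move=> ai a1 a2; apply/eqP; rewrite eq_le -!int_lt_addr1 ?rpred0 //.
by rewrite add0r a2 /= -ltrBlDr sub0r.
Qed.

Lemma simplex_integral s i : simplex s -> integral s -> s 0 i != 0 ->
  s = vertex R i.
Proof.
move=> sS si s0; have [j [k u]] := ord3_others i.
have := simplex_sum u sS; have := sS.1 i; have := sS.1 j; have := sS.1 k.
have s1 : 1 <= s 0 i.
  rewrite -int_lt_addr1 ?rpred1 // ltrDr lt_neqAle eq_sym s0.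
  exact: sS.1.
move=> sk sj sI sum1; apply/rowP.
have : [/\ (j == i) = false & (k == i) = false].
  by move: u; rewrite /= !inE negb_or => /and3P[/andP[/negPf ij /negPf ik] _];
     rewrite ![_ == i]eq_sym.
move=> [ji ki]; apply: (ord3P u); rewrite vertexE ?eqxx ?ji ?ki /=; lra.
Qed.

Lemma barycentric_integral x e n s : barycentric x e n s -> integral x ->
  exists i, s = vertex R i.
Proof.
move=> [eS ni sS xE] xi.
have si : integral s.
  move=> i; have -> : s 0 i = e * (x 0 i - n 0 i).
    by rewrite xE !mxE addrAC subrr add0r mulrA sign_mulK ?mul1r.
  rewrite rpredM ?rpredB //; case: eS => ->; rewrite ?rpredN rpred1 //.
have [i s0] : exists i, s 0 i != 0.
  apply/existsP; rewrite -negb_forall; apply/negP => /forallP s0.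
  have := sS.2; rewrite big1 => [/eqP|i _]; last exact/eqP.
  by rewrite eq_sym oner_eq0.
by exists i; exact: simplex_integral.
Qed.

Lemma vertex_average_integral g x e n s : barycentric x e n s -> integral x ->
  vertex_average g e n s = g x.
Proof.
move=> B xi; have [i sv] := barycentric_integral B xi; have [_ _ _ ->] := B.
rewrite /vertex_average (bigD1 i) //= big1 => [|j ji]; last first.
  by rewrite sv vertexE (negPf ji) mul0r.
by rewrite addr0 sv vertexE eqxx mul1r.
Qed.

Lemma simplex_lt1 x e n s i : barycentric x e n s -> ~ integral x -> s 0 i < 1.
Proof.
move=> [eS ni sS xE] xi; rewrite lt_neqAle simplex_le1 // andbT.
apply/eqP => si; apply: xi.
have [j [k u]] := ord3_others i.
have := simplex_sum u sS; have := sS.1 j; have := sS.1 k => sk sj sum1.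
suff sint : integral s.
  move=> l; rewrite xE !mxE rpredD ?rpredM //.
  by case: eS => ->; rewrite ?rpredN rpred1.
have [sj0 sk0] : s 0 j = 0 /\ s 0 k = 0 by lra.
by apply: (ord3P u); rewrite ?si ?sj0 ?sk0 ?rpred0 ?rpred1.
Qed.

Lemma barycentric_same_sign x e n s n' s' : ~ integral x ->
  barycentric x e n s -> barycentric x e n' s' -> n = n' /\ s = s'.
Proof.
move=> xi B B'; have [eS ni sS xE] := B; have [_ ni' sS' xE'] := B'.
have nn : n = n'.
  apply/rowP => i; apply/eqP; rewrite -subr_eq0; apply/eqP/int_small.
  - by rewrite rpredB.
  - have := congr1 (fun z : 'rV_3 => z 0 i) (etrans (esym xE) xE');
    rewrite !mxE.
    have := simplex_lt1 i B xi; have := simplex_lt1 i B' xi.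
    have := sS.1 i; have := sS'.1 i; case: eS => ->; lra.
  - have := congr1 (fun z : 'rV_3 => z 0 i) (etrans (esym xE) xE');
    rewrite !mxE.
    have := simplex_lt1 i B xi; have := simplex_lt1 i B' xi.
    have := sS.1 i; have := sS'.1 i; case: eS => ->; lra.
split=> //; move: xE'; rewrite xE nn => /addrI; apply: scalerI.
by case: eS => ->; rewrite ?oppr_eq0 oner_eq0.
Qed.

(** The sums s l + s' l are integers in [0, 1] with total 2, so exactly one of
    them is 0. *)
Lemma barycentric_opposite x n s n' s' : ~ integral x ->
    barycentric x 1 n s -> barycentric x (-1) n' s' ->
  exists i j k, [/\ uniq [:: i; j; k], s 0 k = 0, s' 0 k = 0,
    s' 0 i = s 0 j & s' 0 j = s 0 i] /\
    [/\ n' 0 k = n 0 k, n' 0 i = n 0 i + 1 & n' 0 j = n 0 j + 1].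
Proof.
move=> xi B B'; have [_ ni sS xE] := B; have [_ ni' sS' xE'] := B'.
have dE l : s 0 l + s' 0 l = n' 0 l - n 0 l.
  have := congr1 (fun z : 'rV_3 => z 0 l) (etrans (esym xE) xE'); rewrite !mxE.
  lra.
have dint l : s 0 l + s' 0 l \is a Num.int by rewrite dE rpredB.
have d0 l : 0 <= s 0 l + s' 0 l by rewrite addr_ge0 ?sS.1 ?sS'.1.
have d2 l : s 0 l + s' 0 l <= 1.
  rewrite -int_lt_addr1 ?rpred1 //.
  by have := simplex_lt1 l B xi; have := simplex_lt1 l B' xi; lra.
have [k dk] : exists k, s 0 k + s' 0 k != 1.
  apply/existsP; rewrite -negb_forall; apply/negP => /forallP d1.
  have := sS.2; have := sS'.2; have [i [j u]] := ord3_others 0.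
  rewrite !(sum3 u); have /eqP := d1 0; have /eqP := d1 i; have /eqP := d1 j.
  lra.
have dk0 : s 0 k + s' 0 k = 0.
  apply: int_small => //; last by rewrite lt_neqAle dk d2.
  by apply: lt_le_trans (d0 k); rewrite oppr_lt0 ltr01.
have [i [j u]] := ord3_others k.
have := simplex_sum u sS; have := simplex_sum u sS'.
have := sS.1 k; have := sS'.1 k; have := d2 i; have := d2 j.
have := dE i; have := dE j; have := dE k => ek ej ei i1 j1 sk sk' sum sum'.
have u' : uniq [:: i; j; k] by have := rot_uniq 1 [:: k; i; j]; rewrite u.
by exists i, j, k; split; split; first [exact: u' | lra].
Qed.

(** Interpolation is well defined: a point that is not a vertex and lies in
    triangles of both orientations is on their common edge, where both averages
    involve the same two vertices. *)
Lemma vertex_average_unique g x e n s e' n' s' :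
    barycentric x e n s -> barycentric x e' n' s' ->
  vertex_average g e n s = vertex_average g e' n' s'.
Proof.
have [xi|xi] := pselect (integral x).
  by move=> B B'; rewrite !(vertex_average_integral g _ xi).
suff opp m t m' t' : barycentric x 1 m t -> barycentric x (-1) m' t' ->
    vertex_average g 1 m t = vertex_average g (-1) m' t'.
  move=> B B'; have [[] eE _ _ _] := B; have [[] eE' _ _ _] := B'; subst e e'.
  - by have [-> ->] := barycentric_same_sign xi B B'.
  - exact: opp.
  - by apply/esym/opp.
  - by have [-> ->] := barycentric_same_sign xi B B'.
move=> B B'.
have [i [j [k [[u tk tk' ti tj] [mk mi mj]]]]] := barycentric_opposite xi B B'.
rewrite /vertex_average !(sum3 u) tk tk' ti tj !mul0r !addr0 addrC.
have : [/\ i != j, i != k & j != k].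
  by move: u; rewrite /= !inE negb_or => /and3P[/andP[-> ->] ->].
move=> [/negPf ij /negPf ik /negPf jk].
have eqs := (eqxx, ij, ik, jk, eq_sym j i, eq_sym k i, eq_sym k j).
congr (_ * g _ + _ * g _); apply/rowP; apply: (ord3P u);
  rewrite !mxE ?mk ?mi ?mj !eqs /=; lra.
Qed.

(** The value is defined by choice among all representations of x; see
    [vertex_average_unique]. *)
Definition interpolate g x : R := xget 0
  [set v | exists e n s, barycentric x e n s /\ v = vertex_average g e n
    s]%classic.

Lemma interpolateE g x e n s : barycentric x e n s ->
  interpolate g x = vertex_average g e n s.
Proof.
move=> B; rewrite /interpolate; case: xgetP => [v _ [e' [n' [s' [B' ->]]]]|].
  exact: vertex_average_unique B' B.
by move=> /(_ (vertex_average g e n s)) /= []; exists e, n, s.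
Qed.

Lemma interpolate_affine g : cellwise_affine (interpolate g).
Proof.
move=> x /barycentric_cell[e [n [eS ni H]]].
exists (fun i => e * g (n + e *: vertex R i)).
exists (- \sum_i e * n 0 i * g (n + e *: vertex R i)) => y y0 xy.
rewrite (interpolateE _ (H y y0 xy)) /vertex_average -sumrB.
by apply: eq_bigr => i _; rewrite !mxE; ring.
Qed.

Lemma interpolate_integral g x : plane x -> integral x -> interpolate g x = g x.
Proof.
move=> x0 xi; have [e [n [_ _ H]]] := barycentric_cell x0.
have B := H x x0 (fun=> @same_cell_refl _ _).
by rewrite (interpolateE _ B) (vertex_average_integral _ B).
Qed.

End Interpolation.

(** * The plane, its lattices and zero-sum triples *)

Section Coordinates.
Variable R : realType.
Implicit Types (x : 'rV[R]_2) (y : 'rV[R]_3).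

Definition to_plane (N : nat) x : 'rV[R]_3 :=
  \row_i (N%:R * if i == 0 then x 0 0 else if i == 1 then x 0 1
                 else - (x 0 0 + x 0 1)).

(** Inverse of [to_plane] on zero-sum triples; the third coordinate is simply
    forgotten, so integral triples are mapped to lattice points even off the
    plane. *)
Definition from_plane (N : nat) y : 'rV[R]_2 :=
  \row_i (N%:R^-1 * y 0 (if i == 0 then 0 else 1)).

Lemma row2P x x' : x 0 0 = x' 0 0 -> x 0 1 = x' 0 1 -> x = x'.
Proof.
move=> e0 e1; apply/rowP => i; have [->//|->//] : i = 0 \/ i = 1.
by case: i => -[|[|]] // p; [left|right]; apply: val_inj.
Qed.

Lemma to_plane_plane N x : plane (to_plane N x).
Proof. by rewrite /plane (sum3 uniq3) !mxE /=; ring. Qed.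

Section Positive.
Variables (N : nat) (N0 : (0 < N)%N).
Let NR : N%:R != 0 :> R. Proof. by rewrite pnatr_eq0 -lt0n. Qed.

Lemma to_planeK x : from_plane N (to_plane N x) = x.
Proof. by apply: row2P; rewrite !mxE /= mulKf. Qed.

Lemma from_planeK y : plane y -> to_plane N (from_plane N y) = y.
Proof.
move=> /(plane_sum uniq3) y0; apply/rowP; apply: (ord3P uniq3);
rewrite !mxE /= ?mulVKf // -mulrDr mulrN mulVKf //; lra.
Qed.

Lemma from_planeB y y' : from_plane N (y - y') = from_plane N y - from_plane N
  y'.
Proof. by apply/rowP => i; rewrite !mxE mulrBr. Qed.

Lemma from_planeD y y' : from_plane N (y + y') = from_plane N y + from_plane N
  y'.
Proof. by apply/rowP => i; rewrite !mxE mulrDr. Qed.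

Lemma to_planeD x x' : to_plane N (x + x') = to_plane N x + to_plane N x'.
Proof. by apply/rowP; apply: (ord3P uniq3); rewrite !mxE /=; ring. Qed.

Lemma to_planeN x : to_plane N (- x) = - to_plane N x.
Proof. by apply/rowP; apply: (ord3P uniq3); rewrite !mxE /=; ring. Qed.

Lemma to_planeB x x' : to_plane N (x - x') = to_plane N x - to_plane N x'.
Proof. by rewrite to_planeD to_planeN. Qed.

Lemma latticeP x : x \in lattice R N <-> integral (to_plane N x).
Proof.
split=> [/forallP xN i|xi]; last first.
  apply/forallP => i; have [->|->] : i = 0 \/ i = 1.
    by case: i => -[|[|]] // p; [left|right]; apply: val_inj.
  - by have := xi 0; rewrite !mxE.
  - by have := xi 1; rewrite !mxE.
rewrite mxE; case: ifP => _; first exact: xN.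
case: ifP => _; first exact: xN.
by rewrite mulrN rpredN mulrDr rpredD.
Qed.

Lemma from_plane_lattice y : plane y -> integral y ->
  from_plane N y \in lattice R N.
Proof. by move=> y0 yi; apply/latticeP; rewrite from_planeK. Qed.

End Positive.

Lemma to_planeM (m N : nat) x : to_plane (m * N) x = m%:R *: to_plane N x.
Proof. by apply/rowP => i; rewrite !mxE natrM mulrA. Qed.

Lemma from_planeM (m N : nat) y :
  from_plane (m * N) y = from_plane N (m%:R^-1 *: y).
Proof. by apply/rowP => i; rewrite !mxE natrM invfM mulrA (mulrC N%:R^-1). Qed.

(** With v the lattice point of n, the triangle n + simplex corresponds to
    v + conv {0, e1, e2} / q, and n - simplex to the triangle
    conv {e1, e2, e1 + e2} / q translated by v - (e1 + e2) / q. *)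
Lemma cpwl_cellwise_affine (q : nat) (p : 'rV[R]_2 -> R) : (0 < q)%N ->
  cpwl q p -> cellwise_affine (fun y => p (from_plane q y)).
Proof.
move=> q0 pq x /plane_triangle[e [n [eS ni nsum H]]].
pose e1 : 'rV[R]_2 := delta_mx 0 0; pose e2 : 'rV[R]_2 := delta_mx 0 1.
have nsum3 : n 0 0 + n 0 1 + n 0 ord_max = - e by rewrite -(sum3 uniq3).
suff [T [Ttri TP]] : exists T, triangles q T /\
    forall y, plane y -> cell x y -> T (from_plane q y).
  have [a [b E]] := pq T Ttri.
  exists (fun i => if i == 0 then q%:R^-1 * a 0 0
                   else if i == 1 then q%:R^-1 * a 1 0 else 0), b.
  move=> y y0 xy; rewrite E; last exact: TP.
  rewrite (sum3 uniq3) /= mul0r addr0 mxE !big_ord_recl big_ord0 addr0.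
  have -> : lift ord0 ord0 = 1 :> 'I_2 by exact: val_inj.
  by rewrite !mxE /=; ring.
have deltaE (i j : 'I_2) : (delta_mx 0 i : 'rV[R]_2) 0 j = (j == i)%:R.
  by rewrite mxE eqxx.
case: eS => eE; subst e.
- exists (scale_translate q (from_plane q n) (convex_hull [set 0; e1;
  e2]%classic)).
  split.
    exists (from_plane q n); last by left.
    apply/forallP => i; rewrite !mxE mulVKf ?pnatr_eq0 -?lt0n //; exact: ni.
  move=> y y0 xy; have [s0 s1] := H y y0 xy.
  set s := 1 *: (y - n) in s0 s1.
  exists (s 0 0 *: e1 + s 0 1 *: e2).
    exists 3%N, (fun i => s 0 i), (fun i : 'I_3 => if i == 0 then e1
      else if i == 1 then e2 else 0); split=> //.
    + apply: (ord3P uniq3) => /=; [by left; right|by right|by left; left].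
    + by rewrite (sum3 uniq3) /= scaler0 addr0.
  apply: row2P; rewrite !mxE /=; ring.
- exists (scale_translate q (from_plane q n - q%:R^-1 *: (e1 + e2))
    (convex_hull [set e1; e2; e1 + e2]%classic)).
  split.
    exists (from_plane q n - q%:R^-1 *: (e1 + e2)); last by right.
    apply/forallP => i; rewrite !mxE -mulrBr mulVKf ?pnatr_eq0 -?lt0n //.
    by rewrite rpredB ?rpredD ?rpred_nat.
  move=> y y0 xy; have [s0 s1] := H y y0 xy.
  set s := -1 *: (y - n) in s0 s1.
  exists (s 0 0 *: e2 + s 0 1 *: e1 + s 0 ord_max *: (e1 + e2)).
    exists 3%N, (fun i => s 0 i), (fun i : 'I_3 => if i == 0 then e2
      else if i == 1 then e1 else e1 + e2); split=> //.
    + apply: (ord3P uniq3) => /=; [by left; right|by left; left|by right].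
    + by rewrite (sum3 uniq3) /=.
  have s2 : s 0 ord_max = 1 - s 0 0 - s 0 1.
    by rewrite -s1 (sum3 uniq3); ring.
  apply: row2P; rewrite s2 !mxE /=; ring.
Qed.

End Coordinates.

(** * From the plane to the grid *)

Section RestrictionExtreme.
Variables (R : realType) (N : nat) (N0 : (0 < N)%N).
Variables (f : 'rV[R]_2) (fN : f \in lattice R N).

Notation grid := (Defs.latticeType R N).
Notation fgrid := (Lattice fN : grid).
Implicit Types (g : grid -> R) (p : 'rV[R]_2 -> R).

Lemma integral_pointsE (s : grid) :
  (s \in integral_points R N) = (val s \in lattice R 1).
Proof. by []. Qed.

Lemma grid_regular p : regular (lattice R 1) f p ->
  regular (integral_points R N) fgrid (fun x => p (val x)).
Proof.
move=> [p0 pS pD pf]; split.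
- by move=> x; exact: p0.
- by move=> s; rewrite integral_pointsE; exact: pS.
- by move=> x y; exact: pD.
- by move=> x; exact: pf.
Qed.

Definition grid_extension g (x : 'rV[R]_2) : R :=
  interpolate (fun y => g (insubd (0 : grid) (from_plane N y))) (to_plane N x).

Lemma grid_extensionE g (x : grid) : grid_extension g (val x) = g x.
Proof.
have xi : integral (to_plane N (val x)) by apply/latticeP => //; exact: valP.
rewrite /grid_extension interpolate_integral ?to_planeK ?valKd //.
exact: to_plane_plane.
Qed.

Lemma val_insubd_from_plane (y : 'rV[R]_3) : plane y -> integral y ->
  val (insubd (0 : grid) (from_plane N y)) = from_plane N y.
Proof. by move=> y0 yi; rewrite val_insubd from_plane_lattice. Qed.

Lemma cell0 (y : 'rV[R]_3) : cell 0 y -> y = 0.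
Proof.
move=> y0; apply/rowP => i; have := y0 i; rewrite !mxE => /same_cell_int -> //.
Qed.

Lemma plane0 : plane (0 : 'rV[R]_3).
Proof. by rewrite /plane big1 // => i _; rewrite mxE. Qed.

(** Rounding the single row y, completed by - y and 0, compares both functions
    at integral points. *)
Lemma eq_cellwise_affine (h1 h2 : 'rV[R]_3 -> R) y :
    cellwise_affine h1 -> cellwise_affine h2 ->
    (forall z, plane z -> integral z -> h1 z = h2 z) ->
  plane y -> h1 y = h2 y.
Proof.
move=> a1 a2 h12 y0.
have le h h' : cellwise_affine h -> cellwise_affine h' ->
    (forall z, plane z -> integral z -> h z = h' z) -> h' y <= h y.
  move=> a a' hh.
  have := @round_triple R (fun z => h z + -1 * h' z) (fun=> 0) (fun=> 0) 0 y (-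
    y) 0.
  rewrite !addr0 mulN1r subr_ge0; apply=> //; rewrite ?subrr.
  - by apply: cellwise_affineD => //; exact: cellwise_affineZ.
  - exact: cellwise_affine0.
  - exact: cellwise_affine0.
  - exact: planeN.
  - exact: plane0.
  - by move=> i; rewrite mxE rpred0.
  - by move=> z z1 z2 zi _ _ z0 _ _ _ _; rewrite hh // mulN1r subrr !addr0.
by apply/eqP; rewrite eq_le !le // => z z0 zi; rewrite h12.
Qed.

(** By rounding, every property is inherited from integral triples, where it is
    the corresponding property of g. *)
Lemma grid_extension_regular g : regular (integral_points R N) fgrid g ->
  regular (lattice R 1) f (grid_extension g).
Proof.
move=> gR; have [g0 gS gD gf] := gR.
pose G (y : 'rV[R]_3) := g (insubd (0 : grid) (from_plane N y)).
have GE y : plane y -> integral y -> interpolate G y = G y.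
  exact: interpolate_integral.
pose F := to_plane N f.
have Fi : integral F by apply/latticeP.
have F0 : plane F by exact: to_plane_plane.
have Ga : cellwise_affine (interpolate G) by exact: interpolate_affine.
have ge0 x : 0 <= grid_extension g x.
  have := @round_triple R (interpolate G) (fun=> 0) (fun=> 0) 0
    (to_plane N x) (- to_plane N x) 0.
  rewrite !addr0; apply=> //; rewrite ?subrr.
  - exact: cellwise_affine0.
  - exact: cellwise_affine0.
  - exact: to_plane_plane.
  - exact/planeN/to_plane_plane.
  - exact: plane0.
  - by move=> i; rewrite mxE rpred0.
  - by move=> z z1 z2 zi _ _ z0 _ _ _ _; rewrite !addr0 GE // g0.
have Gf y : plane y -> integral y -> G y + G (F - y) = 1.
  move=> y0 yi; rewrite -(gf (insubd 0 (from_plane N y))); congr (_ + g _).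
  apply: val_inj; rewrite /= val_insubd_from_plane ?val_insubd_from_plane //.
  - by rewrite from_planeB to_planeK.
  - exact: planeB.
  - exact: integralB.
have hf x : grid_extension g x + grid_extension g (f - x) = 1.
  pose y := to_plane N x; have y0 : plane y by exact: to_plane_plane.
  rewrite /grid_extension to_planeB -/F -/y -/G.
  have bound (e c : R) : (forall z, plane z -> integral z ->
      c <= e * G z + e * G (F - z)) ->
      c <= e * interpolate G y + e * interpolate G (F - y).
    move=> ec; have := @round_triple R (fun z => e * interpolate G z)
      (fun z => e * interpolate G z) (fun=> 0) c y (F - y) 0.
    rewrite !addr0; apply=> //; rewrite ?subrKC //.
    - exact: cellwise_affineZ.
    - exact: cellwise_affineZ.
    - exact: cellwise_affine0.
    - exact: planeB.
    - exact: plane0.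
    move=> z z1 z2 zi z1i _ z0 z10 _ /cell0 -> ; rewrite addr0 => zF.
    have z1E : z1 = F - z by rewrite -zF addrC addKr.
    by rewrite addr0 !GE // z1E; exact: ec.
  apply/eqP; rewrite eq_le; apply/andP; split; last first.
    have := bound 1 1; rewrite !mul1r; apply => z z0 zi.
    by rewrite !mul1r Gf.
  have := bound (-1) (-1); rewrite !mulN1r -opprD lerN2; apply => z z0 zi.
  by rewrite !mulN1r -opprD Gf.
split=> // [s sS|x y].
  have sN : s \in lattice R N by have := lattice_mul N sS; rewrite muln1.
  rewrite -[s]/(val (Lattice sN : grid)) grid_extensionE gS //.
have : 1 <= grid_extension g x + grid_extension g y + grid_extension g (f - (x
  + y)).
  rewrite /grid_extension -/G.
  apply: round_triple => //; try exact: to_plane_plane.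
    by rewrite -!to_planeD subrKC.
  move=> x' y' w' xi yi wi x0 y0 w0 _; rewrite -!to_planeD subrKC => xyw.
  rewrite !GE //; apply: (regular_triple gR); apply: val_inj.
  by rewrite /= !val_insubd_from_plane // -!from_planeD xyw to_planeK.
have := hf (x + y); lra.
Qed.

(** Since the grid refines the triangulation, p is affine on the small triangles
    as well; so it is the midpoint of the extensions of g1 and g2. *)
Lemma extreme_restriction (q : nat) p : (0 < q)%N -> (q %| N)%N -> cpwl q p ->
    regular (lattice R 1) f p -> extreme (lattice R 1) f p ->
  extreme (integral_points R N) fgrid (fun x => p (val x)).
Proof.
move=> q0 /dvdnP[m mq] pq pR pE; have gR := grid_regular pR.
have m0 : (0 < m)%N by move: N0; rewrite mq muln_gt0 => /andP[].
split=> [|g1 g2 g1v g2v gE]; first exact: regular_valid.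
have g1R : regular (integral_points R N) fgrid g1.
  exact: tight_regular gR g1v (half_tight g1v g2v gE).
have g2R : regular (integral_points R N) fgrid g2.
  apply: tight_regular gR g2v (half_tight g2v g1v _).
  by rewrite gE; apply/funext => r; rewrite addrC.
have [||//|p1 p2] := pE.2 (grid_extension g1) (grid_extension g2).
- exact/regular_valid/grid_extension_regular.
- exact/regular_valid/grid_extension_regular.
- apply/funext => x; rewrite -{1}(to_planeK N0 x) /grid_extension.
  move: (to_plane N x) (to_plane_plane N x) => y.
  pose G (h : grid -> R) (z : 'rV[R]_3) := h (insubd (0 : grid) (from_plane N
    z)).
  apply: (@eq_cellwise_affine (fun z => p (from_plane N z))
    (fun z => 2^-1 * (interpolate (G g1) z + interpolate (G g2) z))).
  + have := cellwise_affine_refine m0 (cpwl_cellwise_affine q0 pq).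
    by congr cellwise_affine; apply/funext => z; rewrite mq from_planeM.
  + by apply/cellwise_affineZ/cellwise_affineD; exact: interpolate_affine.
  move=> z z0 zi; rewrite !interpolate_integral //.
  have /(congr1 (fun h => h (insubd 0 (from_plane N z)))) := gE.
  by rewrite /= val_insubd_from_plane.
by split; apply/funext => x; rewrite -grid_extensionE;
  [rewrite -p1|rewrite -p2].
Qed.

End RestrictionExtreme.

(** * Additive functions on the unit interval and on a triangle *)

Section Cauchy.
Variable R : realType.
Implicit Types (A g : R -> R) (a b c : R).

Definition unit_bounded A := exists M, forall a, 0 <= a -> a <= 1 ->
  `|A a| <= M.

(** A vanishes at the multiples of 1/n, hence A a = A r for some r <= 1/n, and
    n * |A r| = |A (n r)| is bounded by M; let n grow. *)
Lemma additive_unit_zero A : unit_bounded A -> A 1 = 0 ->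
    (forall a b, 0 <= a -> 0 <= b -> a + b <= 1 -> A (a + b) = A a + A b) ->
  forall a, 0 <= a -> a <= 1 -> A a = 0.
Proof.
move=> [M AM] A1 AD a a0 a1.
have AMn n b : 0 <= b -> n%:R * b <= 1 -> A (n%:R * b) = n%:R * A b.
  move=> b0; elim: n => [|n IH] nb.
    have := AD 0 0 (lexx _) (lexx _); rewrite addr0 => /(_ ler01).
    rewrite !mul0r; lra.
  have nb0 : 0 <= n%:R * b by rewrite mulr_ge0.
  move: nb; rewrite -[n.+1]addn1 natrD !mulrDl !mul1r => nb.
  rewrite AD // IH //; lra.
have bound n : n.+1%:R * `|A a| <= M.
  have n0 : 0 < n.+1%:R :> R by rewrite ltr0n.
  have An : A n.+1%:R^-1 = 0.
    have := AMn n.+1 n.+1%:R^-1; rewrite invr_ge0 ltW // mulfV ?gt_eqF //.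
    move=> /(_ isT (lexx _)); rewrite A1 => /esym/eqP.
    by rewrite mulf_eq0 gt_eqF //= => /eqP.
  have na0 : 0 <= n.+1%:R * a by rewrite mulr_ge0 // ltW.
  pose k := Num.truncn (n.+1%:R * a).
  have /andP[ka ak] : k%:R <= n.+1%:R * a < k.+1%:R by exact: truncn_itv.
  pose r := a - k%:R / n.+1%:R.
  have r0 : 0 <= r by rewrite subr_ge0 ler_pdivrMr // mulrC.
  have nr : n.+1%:R * r <= 1.
    rewrite /r mulrBr mulrCA mulfV ?gt_eqF // mulr1 lerBlDl.
    by rewrite (le_trans (ltW ak)) // -natr1.
  have kn : k%:R / n.+1%:R <= 1 :> R by apply: (le_trans _ a1);
    rewrite -subr_ge0.
  have -> : A a = A r.
    have -> : a = k%:R / n.+1%:R + r by rewrite subrKC.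
    have kn0 : 0 <= k%:R / n.+1%:R :> R by rewrite divr_ge0.
    rewrite AD //; last by rewrite subrKC.
    have ni0 : 0 <= n.+1%:R^-1 :> R by rewrite invr_ge0 ltW.
    by rewrite (AMn _ _ ni0 kn) An mulr0 add0r.
  rewrite -(gtr0_norm n0) -normrM -AMn //.
  by apply: AM => //; apply: mulr_ge0 => //; exact: ltW.
have [//|] := eqVneq (A a) 0; rewrite -normr_gt0 => Aa.
have M0 : 0 <= M / `|A a|.
  by rewrite divr_ge0 // ltW // (lt_le_trans Aa) // (le_trans _ (AM a a0 a1)).
have := truncn_itv M0 => /andP[_].
by rewrite ltr_pdivrMr // ltNge bound.
Qed.

(** The functions of one barycentric coordinate that occur are bounded and zero
    at the ends, since phi vanishes at vertices.  This normalization makes sums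
    of such functions unique. *)
Definition tame A := [/\ A 0 = 0, A 1 = 0 & unit_bounded A].

Lemma tame_rev A : tame A -> tame (fun a => A (1 - a)).
Proof.
move=> [A0 A1 [M AM]]; split; rewrite ?subr0 ?subrr //.
by exists M => a a0 a1; apply: AM; lra.
Qed.

Lemma tameN A : tame A -> tame (fun a => - A a).
Proof.
move=> [A0 A1 [M AM]]; split; rewrite ?A0 ?A1 ?oppr0 //.
by exists M => a a0 a1; rewrite normrN; exact: AM.
Qed.

Lemma tameB A B : tame A -> tame B -> tame (fun a => A a - B a).
Proof.
move=> [A0 A1 [M AM]] [B0 B1 [K BK]]; split; rewrite ?A0 ?A1 ?B0 ?B1 ?subrr //.
exists (M + K) => a a0 a1; apply: le_trans (ler_normB _ _) _.
by rewrite lerD ?AM ?BK.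
Qed.

Lemma tame0 : tame (fun=> 0 : R).
Proof. by split=> //; exists 0 => a _ _; rewrite normr0. Qed.

Section Point.
Variables (i j k : 'I_3) (u : uniq [:: i; j; k]).

Definition point3 (a b c : R) : 'rV[R]_3 :=
  a *: vertex R i + b *: vertex R j + c *: vertex R k.

Lemma point3E a b c : [/\ point3 a b c 0 i = a, point3 a b c 0 j = b &
  point3 a b c 0 k = c].
Proof.
move: (u); rewrite /= !inE negb_or => /and3P[/andP[/negPf ij /negPf ik] /negPf
  jk _].
by split; rewrite !mxE !eqxx ?(eq_sym j i) ?(eq_sym k i) ?(eq_sym k j) ?ij ?ik
  ?jk /=; ring.
Qed.

Lemma simplex_point3 a b c : 0 <= a -> 0 <= b -> 0 <= c -> a + b + c = 1 ->
  simplex (point3 a b c).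
Proof.
move=> a0 b0 c0 abc; have [E1 E2 E3] := point3E a b c.
split; last by rewrite (sum3 u) E1 E2 E3.
by apply: (ord3P u); rewrite ?E1 ?E2 ?E3.
Qed.

Lemma eq_point3 (s : 'rV[R]_3) a b c : s 0 i = a -> s 0 j = b -> s 0 k = c ->
  s = point3 a b c.
Proof.
move=> si sj sk; have [E1 E2 E3] := point3E a b c.
by apply/rowP; apply: (ord3P u); rewrite ?E1 ?E2 ?E3.
Qed.

End Point.

(** On the edges of the triangle the three functions agree and are odd about
    1/2; the relation inside then says that they are additive. *)
Lemma sum_zero_on_simplex (A : 'I_3 -> R -> R) : (forall i, tame (A i)) ->
    (forall s, simplex s -> \sum_i A i (s 0 i) = 0) ->
  forall i a, 0 <= a -> a <= 1 -> A i a = 0.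
Proof.
move=> At As i; have [j [k u]] := ord3_others i.
have at3 a b c : 0 <= a -> 0 <= b -> 0 <= c -> a + b + c = 1 ->
    A i a + A j b + A k c = 0.
  move=> a0 b0 c0 abc; have := As _ (simplex_point3 u a0 b0 c0 abc).
  by rewrite (sum3 u); have [-> -> ->] := point3E u a b c.
have [Ai0 Ai1 Ab] := At i; have [Aj0 Aj1 _] := At j; have [Ak0 Ak1 _] := At k.
have edge a : 0 <= a -> a <= 1 -> A j a = A i a /\ A k (1 - a) = - A i a.
  move=> a0 a1; have := at3 a (1 - a) 0; have := at3 0 (1 - a) a.
  have := at3 a 0 (1 - a); have := at3 0 a (1 - a).
  rewrite Ai0 Aj0 Ak0 => H1 H2 H3 H4.
  by rewrite (_ : A k (1 - a) = - A j a); [|have := H1; lra]; have := H1;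
    have := H2; lra.
apply: additive_unit_zero => // a b a0 b0 ab.
have := at3 a b (1 - (a + b)) a0 b0.
have [_ ->] : A j (a + b) = A i (a + b) /\ A k (1 - (a + b)) = - A i (a + b).
  by apply: edge => //; rewrite addr_ge0.
have [-> _] : A j b = A i b /\ A k (1 - b) = - A i b by apply: edge => //; lra.
by rewrite subr_ge0 subrKC => /(_ ab erefl); lra.
Qed.

End Cauchy.

(** * Functional equations on edges and triangles *)

Section LocalEquations.
Variable R : realType.
Implicit Types (h hx hy hw : 'rV[R]_3 -> R) (r s : 'rV[R]_3).

(** What is known of phi in the coordinates of one triangle.  The last condition
    concerns no point of the simplex; it makes h harmless at the substitute 0
    used in [local_value]. *)
Definition triangle_function h :=
  [/\ exists M, forall s, simplex s -> `|h s| <= M,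
      forall i, h (vertex R i) = 0 & h 0 = 0].

(** Only two terms are allowed: with three, a nonzero sum could vanish on all
    edges of the triangle. *)
Definition decomposes h (A : 'I_3 -> R -> R) :=
  [/\ forall i, tame (A i), exists i, forall a, A i a = 0 &
      forall s, simplex s -> h s = \sum_i A i (s 0 i)].

Lemma decomposes_unique h A B : decomposes h A -> decomposes h B ->
  forall i a, 0 <= a -> a <= 1 -> A i a = B i a.
Proof.
move=> [At _ hA] [Bt _ hB] i a a0 a1; apply/eqP; rewrite -subr_eq0; apply/eqP.
apply: (@sum_zero_on_simplex _ (fun i a => A i a - B i a)) => //.
  by move=> l; apply: tameB.
by move=> s sS; rewrite sumrB -hA // -hB // subrr.
Qed.

Definition depends_on h k := exists g, tame g /\ forall s, simplex s ->
  h s = g (s 0 k).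

Section Coordinates.
Variables (i j k : 'I_3) (u : uniq [:: i; j; k]).
Let nij : (j == i) = false /\ (k == i) = false /\ (k == j) = false.
Proof.
move: (u); rewrite /= !inE negb_or => /and3P[/andP[/negPf ij /negPf ik] /negPf
  jk _].
by rewrite (eq_sym j) (eq_sym k i) (eq_sym k j).
Qed.

Definition assign (a b c : R -> R) (l : 'I_3) : R -> R :=
  if l == i then a else if l == j then b else c.

Lemma assignE a b c : [/\ assign a b c i = a, assign a b c j = b &
  assign a b c k = c].
Proof. by rewrite /assign !eqxx; have [-> [-> ->]] := nij. Qed.

Lemma sum_assign a b c (v : 'I_3 -> R) :
  \sum_l assign a b c l (v l) = a (v i) + b (v j) + c (v k).
Proof. by rewrite (sum3 u); have [-> -> ->] := assignE a b c. Qed.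

Lemma tame_assign a b c : tame a -> tame b -> tame c ->
  forall l, tame (assign a b c l).
Proof.
by move=> at_ bt ct; have [E1 E2 E3] := assignE a b c;
  apply: (ord3P u); rewrite ?E1 ?E2 ?E3.
Qed.

Lemma sum_zero3 a b c : tame a -> tame b -> tame c ->
    (forall s, simplex s -> a (s 0 i) + b (s 0 j) + c (s 0 k) = 0) ->
  forall t, 0 <= t -> t <= 1 -> [/\ a t = 0, b t = 0 & c t = 0].
Proof.
move=> at_ bt ct H t t0 t1.
have := @sum_zero_on_simplex _ _ (tame_assign at_ bt ct).
case: (assignE a b c) => E1 E2 E3 Z.
have Z' l : assign a b c l t = 0.
  by apply: Z => // s sS; rewrite sum_assign; exact: H.
by split; [rewrite -E1|rewrite -E2|rewrite -E3]; exact: Z'.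
Qed.

Lemma point3_vertex :
  [/\ point3 i j k 1 0 0 = vertex R i, point3 i j k 0 1 0 = vertex R j &
      point3 i j k 0 0 1 = vertex R k].
Proof. by rewrite /point3 !scale0r !scale1r !add0r !addr0. Qed.

Lemma edge_point (t : R) : 0 <= t -> t <= 1 ->
  [/\ simplex (point3 i j k t (1 - t) 0), simplex (point3 i j k 0 t (1 - t)) &
      simplex (point3 i j k t 0 (1 - t))].
Proof. by move=> t0 t1; split; apply: simplex_point3 => //; lra. Qed.

Lemma tame_edges h : triangle_function h ->
  [/\ tame (fun t => h (point3 i j k t (1 - t) 0)),
      tame (fun t => h (point3 i j k 0 t (1 - t))) &
      tame (fun t => h (point3 i j k t 0 (1 - t)))].
Proof.
move=> [[M hM] hv _]; have [Vi Vj Vk] := point3_vertex.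
by split; split; rewrite ?subr0 ?subrr ?Vi ?Vj ?Vk ?hv //;
  exists M => t t0 t1; apply: hM; have [] := edge_point t0 t1.
Qed.

Lemma simplex_zero_at s : simplex s -> s 0 k = 0 ->
  s = point3 i j k (s 0 i) (1 - s 0 i) 0.
Proof. by move=> sS sk; apply: (eq_point3 u) => //; have := simplex_sum u sS;
  lra. Qed.

(** h s = g (s j) = g' (s k) is a decomposition of 0. *)
Lemma depends_zero h : depends_on h j -> depends_on h k ->
  forall s, simplex s -> h s = 0.
Proof.
move=> [g [gt hg]] [g' [gt' hg']] s sS; rewrite hg //.
have Z := @sum_zero3 (fun=> 0) g (fun a => - g' a) (@tame0 _) gt (tameN gt').
have [|//] := Z _ (s 0 j) (sS.1 j) (simplex_le1 j sS).
by move=> r rS; rewrite add0r -hg // -hg' // subrr.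
Qed.

Lemma decomposes_depends h : depends_on h k ->
  exists g, decomposes h (assign (fun=> 0) (fun=> 0) g) /\
    forall s, simplex s -> h s = g (s 0 k).
Proof.
move=> [g [gt hg]]; exists g; split=> //; split.
- by apply: tame_assign => //; exact: tame0.
- by exists i => a; rewrite /assign eqxx.
- by move=> s sS; rewrite sum_assign !add0r hg.
Qed.

(** Letting y run over the edges r' i = 0 and r' j = 0 of its triangle yields
    two decompositions of hw that share only the coordinate k.  By uniqueness
    the other terms vanish, and these are the values of hx on its edge. *)
Lemma edge_triangle_half hx hy hw :
    triangle_function hx -> triangle_function hy -> triangle_function hw ->
    (forall r r' r'', simplex r -> simplex r' -> simplex r'' -> r 0 k = 0 ->
      (forall l, r 0 l + r' 0 l + r'' 0 l = 1) -> hx r + hy r' + hw r'' = 0) ->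
  (forall r, simplex r -> r 0 k = 0 -> hx r = 0) /\ depends_on hw k.
Proof.
move=> px py pw rel.
pose A a := - hx (point3 i j k (1 - a) a 0).
pose A' c := - hy (point3 i j k 0 c (1 - c)).
pose B a := - hx (point3 i j k a (1 - a) 0).
pose B' c := - hy (point3 i j k c 0 (1 - c)).
have [Bt _ _] := tame_edges px; have [_ A't B't] := tame_edges py.
have At : tame A.
  have := tameN (tame_rev Bt).
  by congr tame; apply/funext => a; rewrite /A subKr.
have E1 s : simplex s -> hw s = A (s 0 i) + A' (s 0 k).
  move=> sS; have ss := simplex_sum u sS; rewrite /A /A'.
  have [s0i s0j s0k] : [/\ 0 <= s 0 i, 0 <= s 0 j & 0 <= s 0 k] by rewrite
    !sS.1.
  have := rel (point3 i j k (1 - s 0 i) (s 0 i) 0)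
    (point3 i j k 0 (s 0 k) (1 - s 0 k)) s.
  have [Ei Ej Ek] := point3E u (1 - s 0 i) (s 0 i) 0.
  have [Ei' Ej' Ek'] := point3E u 0 (s 0 k) (1 - s 0 k).
  have H : forall l, point3 i j k (1 - s 0 i) (s 0 i) 0 0 l + 
    point3 i j k 0 (s 0 k) (1 - s 0 k) 0 l + s 0 l = 1.
    by apply: (ord3P u); rewrite ?Ei ?Ej ?Ek ?Ei' ?Ej' ?Ek'; lra.
  move=> /(_ _ _ sS Ek H); move=> H'.
  have := H' (simplex_point3 u _ _ _ _) (simplex_point3 u _ _ _ _); lra.
have E2 s : simplex s -> hw s = B (s 0 j) + B' (s 0 k).
  move=> sS; have ss := simplex_sum u sS; rewrite /B /B'.
  have [s0i s0j s0k] : [/\ 0 <= s 0 i, 0 <= s 0 j & 0 <= s 0 k] by rewrite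
    !sS.1.
  have := rel (point3 i j k (s 0 j) (1 - s 0 j) 0)
    (point3 i j k (s 0 k) 0 (1 - s 0 k)) s.
  have [Ei Ej Ek] := point3E u (s 0 j) (1 - s 0 j) 0.
  have [Ei' Ej' Ek'] := point3E u (s 0 k) 0 (1 - s 0 k).
  have H : forall l, point3 i j k (s 0 j) (1 - s 0 j) 0 0 l + 
    point3 i j k (s 0 k) 0 (1 - s 0 k) 0 l + s 0 l = 1.
    by apply: (ord3P u); rewrite ?Ei ?Ej ?Ek ?Ei' ?Ej' ?Ek'; lra.
  move=> /(_ _ _ sS Ek H); move=> H'.
  have := H' (simplex_point3 u _ _ _ _) (simplex_point3 u _ _ _ _); lra.
have Z t : 0 <= t -> t <= 1 -> A t = 0.
  move=> t0 t1; have BNt : tame (fun a => - B a) by apply/tameN/tameN.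
  have C't : tame (fun a => A' a - B' a) by apply: tameB; exact: tameN.
  have [|//] := @sum_zero3 A (fun a => - B a) _ At BNt C't _ t t0 t1.
  by move=> s sS; have := E1 s sS; have := E2 s sS; lra.
split=> [r rS rk|].
  have := Z (1 - r 0 i); rewrite /A subKr -simplex_zero_at //.
  have := rS.1 i; have := simplex_le1 i rS => r0 r1.
  by rewrite subr_ge0 r0 lerBlDr lerDl r1 => /(_ isT isT)/eqP;
    rewrite oppr_eq0 => /eqP.
exists A'; split; first exact: tameN.
by move=> s sS; rewrite E1 // Z ?add0r ?simplex_le1 //; exact: sS.1.
Qed.

Lemma edge_triangle_triangle hx hy hw :
    triangle_function hx -> triangle_function hy -> triangle_function hw ->
    (forall r r' r'', simplex r -> simplex r' -> simplex r'' -> r 0 k = 0 ->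
      (forall l, r 0 l + r' 0 l + r'' 0 l = 1) -> hx r + hy r' + hw r'' = 0) ->
  [/\ forall r, simplex r -> r 0 k = 0 -> hx r = 0, depends_on hy k &
    depends_on hw k].
Proof.
move=> px py pw rel.
have [hx0 hwk] := edge_triangle_half px py pw rel.
have [|_ hyk] := @edge_triangle_half hx hw hy px pw py; last by split.
move=> r r' r'' rS rS' rS'' rk rl; rewrite addrAC.
by apply: rel => // l; rewrite addrAC.
Qed.

(** When all three points are on the edges with k-th coordinate 0, the equation
    is that of three parallel edges, so hx vanishes on its edge.  Then y on the
    edge with j-th coordinate 0, and w on the one with i-th coordinate 0,
    express hw and hy by the coordinate k. *)
Lemma edge_triangle_opposite hx hy hw :
    triangle_function hx -> triangle_function hy -> triangle_function hw ->
    (forall r r' r'', simplex r -> simplex r' -> simplex r'' -> r 0 k = 0 ->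
      (forall l, r 0 l + r' 0 l - r'' 0 l = (l == i)%:R) ->
      hx r + hy r' + hw r'' = 0) ->
  [/\ forall r, simplex r -> r 0 k = 0 -> hx r = 0, depends_on hy k &
    depends_on hw k].
Proof.
move=> px py pw rel.
have [nji [nki nkj]] := nij.
have rel' a b c a' b' c' a'' b'' c'' : c = 0 ->
    0 <= a -> 0 <= b -> 0 <= a' -> 0 <= b' -> 0 <= c' ->
    0 <= a'' -> 0 <= b'' -> 0 <= c'' ->
    a + b = 1 -> a' + b' + c' = 1 -> a'' + b'' + c'' = 1 ->
    a + a' - a'' = 1 -> b + b' - b'' = 0 -> c' = c'' ->
    hx (point3 i j k a b c) + hy (point3 i j k a' b' c') +
    hw (point3 i j k a'' b'' c'') = 0.
  move=> c0 *.
  have [Ei Ej Ek] := point3E u a b c.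
  have [Ei' Ej' Ek'] := point3E u a' b' c'.
  have [Ei'' Ej'' Ek''] := point3E u a'' b'' c''.
  apply: rel; try (apply: simplex_point3 => //; lra); first by rewrite Ek.
  apply: (ord3P u); rewrite ?Ei ?Ej ?Ek ?Ei' ?Ej' ?Ek' ?Ei'' ?Ej'' ?Ek''
    ?eqxx ?nji ?nki /=; lra.
have [xt _ _] := tame_edges px; have [yt _ yt'] := tame_edges py.
have [wt wt' _] := tame_edges pw.
have hx0 r : simplex r -> r 0 k = 0 -> hx r = 0.
  move=> rS rk; rewrite (simplex_zero_at rS rk).
  pose A t := hx (point3 i j k (1 - t) t 0).
  pose B t := hy (point3 i j k (1 - t) t 0).
  pose C t := hw (point3 i j k t (1 - t) 0).
  have At : tame A.
    by have := tame_rev xt; congr tame; apply/funext => t; rewrite /A subKr.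
  have Bt : tame B.
    by have := tame_rev yt; congr tame; apply/funext => t; rewrite /B subKr.
  have r0 := rS.1 i; have r1 := simplex_le1 i rS.
  have [| | |+ _ _] := @sum_zero3 A B C At Bt wt _ (1 - r 0 i).
  - move=> s sS; have ss := simplex_sum u sS; rewrite /A /B /C.
    have [s0i s0j s0k] : [/\ 0 <= s 0 i, 0 <= s 0 j & 0 <= s 0 k] by rewrite
      !sS.1.
    apply: rel'; lra.
  - lra.
  - lra.
  - by rewrite /A subKr.
split=> //.
- exists (fun c => - hw (point3 i j k 0 (1 - c) c)); split.
    have := tameN (tame_rev wt').
    by congr tame; apply/funext => t; rewrite subKr.
  move=> s sS; have ss := simplex_sum u sS.
  have [s0i s0j s0k] : [/\ 0 <= s 0 i, 0 <= s 0 j & 0 <= s 0 k] by rewrite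
    !sS.1.
  have := rel' (1 - s 0 i) (s 0 i) 0 (s 0 i) (s 0 j) (s 0 k) 0 (1 - s 0 k) (s 0
    k).
  rewrite hx0; last 2 first.
  - by apply: simplex_point3 => //; lra.
  - by have [] := point3E u (1 - s 0 i) (s 0 i) 0.
  rewrite -(@eq_point3 _ _ _ _ u s (s 0 i) (s 0 j) (s 0 k)) // => H.
  by apply/eqP; rewrite -addr_eq0 -[hy s]add0r H //; lra.
- exists (fun c => - hy (point3 i j k (1 - c) 0 c)); split.
    have := tameN (tame_rev yt').
    by congr tame; apply/funext => t; rewrite subKr.
  move=> s sS; have ss := simplex_sum u sS.
  have [s0i s0j s0k] : [/\ 0 <= s 0 i, 0 <= s 0 j & 0 <= s 0 k] by rewrite
    !sS.1.
  have := rel' (1 - s 0 j) (s 0 j) 0 (1 - s 0 k) 0 (s 0 k) (s 0 i) (s 0 j) (s 0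
    k).
  rewrite hx0; last 2 first.
  - by apply: simplex_point3 => //; lra.
  - by have [] := point3E u (1 - s 0 j) (s 0 j) 0.
  rewrite -(@eq_point3 _ _ _ _ u s (s 0 i) (s 0 j) (s 0 k)) // => H.
  by apply/eqP; rewrite -addr_eq0 addrC -[hy _]add0r H //; lra.
Qed.

End Coordinates.

(** Restricting x to two different edges shows that hy and hw depend on one
    coordinate only, in two ways; so they vanish.  The same holds with x and y
    exchanged. *)
Lemma triangles_same_zero hx hy hw :
    triangle_function hx -> triangle_function hy -> triangle_function hw ->
    (forall r r' r'', simplex r -> simplex r' -> simplex r'' ->
      (forall l, r 0 l + r' 0 l + r'' 0 l = 1) -> hx r + hy r' + hw r'' = 0) ->
  [/\ forall r, simplex r -> hx r = 0, forall r, simplex r -> hy r = 0 &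
    forall r, simplex r -> hw r = 0].
Proof.
move=> px py pw rel.
have u : uniq [:: 0; 1; ord_max : 'I_3] by [].
have u' : uniq [:: 0; ord_max; 1 : 'I_3] by [].
suff H h1 h2 h3 : triangle_function h1 -> triangle_function h2 ->
  triangle_function h3 ->
    (forall r r' r'', simplex r -> simplex r' -> simplex r'' ->
      (forall l, r 0 l + r' 0 l + r'' 0 l = 1) -> h1 r + h2 r' + h3 r'' = 0) ->
    (forall r, simplex r -> h2 r = 0) /\ (forall r, simplex r -> h3 r = 0).
  have [hy0 hw0] := H _ _ _ px py pw rel.
  have [|hx0 _] := H hy hx hw py px pw; last by split.
  move=> r r' r'' rS rS' rS'' rl; rewrite (addrC (hy r)).
  by apply: rel => // l; rewrite (addrC (r' 0 l)).
move=> p1 p2 p3 rel'.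
have [_ a2 a3] := edge_triangle_triangle u p1 p2 p3
  (fun r r' r'' rS rS' rS'' _ => rel' r r' r'' rS rS' rS'').
have [_ b2 b3] := edge_triangle_triangle u' p1 p2 p3
  (fun r r' r'' rS rS' rS'' _ => rel' r r' r'' rS rS' rS'').
by split; [exact: depends_zero u _ b2 a2 | exact: depends_zero u _ b3 a3].
Qed.

(** As [triangles_same_zero], with the two edges of x through the vertex i. *)
Lemma triangles_opposite_zero (i : 'I_3) hx hy hw :
    triangle_function hx -> triangle_function hy -> triangle_function hw ->
    (forall r r' r'', simplex r -> simplex r' -> simplex r'' ->
      (forall l, r 0 l + r' 0 l - r'' 0 l = (l == i)%:R) ->
      hx r + hy r' + hw r'' = 0) ->
  [/\ forall r, simplex r -> hx r = 0, forall r, simplex r -> hy r = 0 &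
    forall r, simplex r -> hw r = 0].
Proof.
move=> px py pw rel; have [j [k u]] := ord3_others i.
have u' : uniq [:: i; k; j].
  by move: u; rewrite /= !inE !negb_or (eq_sym k j) => /and3P[/andP[-> ->] ->].
suff H h1 h2 h3 : triangle_function h1 -> triangle_function h2 ->
  triangle_function h3 ->
    (forall r r' r'', simplex r -> simplex r' -> simplex r'' ->
      (forall l, r 0 l + r' 0 l - r'' 0 l = (l == i)%:R) ->
      h1 r + h2 r' + h3 r'' = 0) ->
    (forall r, simplex r -> h2 r = 0) /\ (forall r, simplex r -> h3 r = 0).
  have [hy0 hw0] := H _ _ _ px py pw rel.
  have [|hx0 _] := H hy hx hw py px pw; last by split.
  move=> r r' r'' rS rS' rS'' rl; rewrite (addrC (hy r)).
  by apply: rel => // l; rewrite (addrC (r' 0 l)).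
move=> p1 p2 p3 rel'.
have [_ a2 a3] := edge_triangle_opposite u p1 p2 p3
  (fun r r' r'' rS rS' rS'' _ => rel' r r' r'' rS rS' rS'').
have [_ b2 b3] := edge_triangle_opposite u' p1 p2 p3
  (fun r r' r'' rS rS' rS'' _ => rel' r r' r'' rS rS' rS'').
by split; [exact: depends_zero u _ b2 a2 | exact: depends_zero u _ b3 a3].
Qed.

Lemma edge_edge_triangle (i j k : 'I_3) hx hy hw : uniq [:: i; j; k] ->
    triangle_function hx -> triangle_function hy -> triangle_function hw ->
    (forall r r' r'', simplex r -> simplex r' -> simplex r'' ->
      r 0 k = 0 -> r' 0 j = 0 ->
      (forall l, r 0 l + r' 0 l + r'' 0 l = 1) -> hx r + hy r' + hw r'' = 0) ->
  decomposes hw (assign i j (fun=> 0)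
    (fun a => - hx (point3 i j k a (1 - a) 0))
    (fun c => - hy (point3 i j k c 0 (1 - c)))).
Proof.
move=> u px py pw rel; split.
- have [xt _ _] := tame_edges u px; have [_ _ yt] := tame_edges u py.
  exact: (tame_assign u (@tame0 _) (tameN xt) (tameN yt)).
- by exists i => a; rewrite /assign eqxx.
move=> s sS; rewrite (sum_assign u) add0r; have ss := simplex_sum u sS.
have [s0i s0j s0k] : [/\ 0 <= s 0 i, 0 <= s 0 j & 0 <= s 0 k] by rewrite !sS.1.
have [Ei Ej Ek] := point3E u (s 0 j) (1 - s 0 j) 0.
have [Ei' Ej' Ek'] := point3E u (s 0 k) 0 (1 - s 0 k).
have H : forall l, point3 i j k (s 0 j) (1 - s 0 j) 0 0 l +
    point3 i j k (s 0 k) 0 (1 - s 0 k) 0 l + s 0 l = 1.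
  by apply: (ord3P u); rewrite ?Ei ?Ej ?Ek ?Ei' ?Ej' ?Ek'; lra.
have := rel _ _ _ (simplex_point3 u _ _ _ _) (simplex_point3 u _ _ _ _) sS Ek
  Ej' H.
lra.
Qed.

(** The parameters of the edges are barycentric coordinates of a triangle, on
    which the sum of the three edge functions is zero. *)
Lemma parallel_edges_zero (i j k : 'I_3) hx hy hw : uniq [:: i; j; k] ->
    triangle_function hx -> triangle_function hy -> triangle_function hw ->
    (forall r r' r'', simplex r -> simplex r' -> simplex r'' ->
      r 0 k = 0 -> r' 0 k = 0 -> r'' 0 k = 0 ->
      r 0 i + r' 0 i + r'' 0 i = 1 -> hx r + hy r' + hw r'' = 0) ->
  forall r, simplex r -> r 0 k = 0 -> [/\ hx r = 0, hy r = 0 & hw r = 0].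
Proof.
move=> u px py pw rel r rS rk.
have [xt _ _] := tame_edges u px; have [yt _ _] := tame_edges u py.
have [wt _ _] := tame_edges u pw.
rewrite (simplex_zero_at u rS rk).
have E (a : R) : [/\ point3 i j k a (1 - a) 0 0 i = a & point3 i j k a (1 - a)
  0 0 k = 0].
  by have [] := point3E u a (1 - a) 0.
apply: (sum_zero3 u xt yt wt) => [s sS||]; last 2 first.
- exact: rS.1.
- exact: simplex_le1.
have edge l : simplex (point3 i j k (s 0 l) (1 - s 0 l) 0).
  by have [] := edge_point u (sS.1 l) (simplex_le1 l sS).
have [Ei Ei0] := E (s 0 i); have [Ej Ej0] := E (s 0 j).
have [Ek Ek0] := E (s 0 k).
by apply: rel => //; rewrite Ei Ej Ek (simplex_sum u).
Qed.

End LocalEquations.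

(** * Moving edge values to new parameters *)

Section Transfer.
Variables (R : realType) (m : nat) (m3 : (3 <= m)%N).
Variables (t0 : R) (t0_ge0 : 0 <= t0) (t0_le1 : t0 <= 1).
Variables (c0 : 'rV[R]_3) (c0S : simplex c0).
Implicit Types (h hx hy hw : 'rV[R]_3 -> R) (r s : 'rV[R]_3).

Local Notation d := (m%:R^-1 : R).

Lemma step_bounds : 0 < d /\ 3 * d <= 1.
Proof.
have m0 : 0 < m%:R :> R by rewrite ltr0n (leq_trans _ m3).
by split; rewrite ?invr_gt0 // ler_pdivrMr // mul1r (ler_nat R 3 m).
Qed.

(** [tau] sends the new parameter of an edge value to the old one; 0 stands for
    the parameters that receive the value 0. *)
Definition tau (a : R) : R :=
  if a == d then t0 else if a == 1 - d then 1 - t0 else 0.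

Lemma tau_ge0 a : 0 <= tau a.
Proof. by rewrite /tau; case: ifP => // _; case: ifP => // _;
  rewrite subr_ge0. Qed.

Lemma tau_le1 a : tau a <= 1.
Proof.
rewrite /tau; case: ifP => // _; case: ifP => _; last exact: ler01.
by rewrite gerBl.
Qed.

Lemma tau0 : tau 0 = 0.
Proof.
have [d0 d1] := step_bounds; rewrite /tau; case: eqP => [|_]; first lra.
by case: eqP => //; lra.
Qed.

Lemma tau1 : tau 1 = 0.
Proof.
have [d0 d1] := step_bounds; rewrite /tau; case: eqP => [|_]; first lra.
by case: eqP => //; lra.
Qed.

(** Reversing an edge commutes with the transfer, up to the end at which the
    value 0 is taken. *)
Lemma tau_rev a : tau (1 - a) = 1 - tau a \/ tau (1 - a) = 0 /\ tau a = 0.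
Proof.
have [d0 d1] := step_bounds; rewrite /tau.
have [->|ad] := eqVneq a d.
  by left; rewrite eqxx; case: eqP => //; lra.
have [->|ad'] := eqVneq a (1 - d).
  by left; rewrite subKr eqxx subKr.
right; rewrite (_ : (1 - a == d) = false); last by apply/eqP => H;
  case/eqP: ad'; lra.
by rewrite (_ : (1 - a == 1 - d) = false) //; apply/eqP => H; case/eqP: ad; lra.
Qed.

Lemma tame_tau_rev A a : tame A -> A (tau (1 - a)) = A (1 - tau a).
Proof.
move=> [A0 A1 _]; have [->//|[-> ->]] := tau_rev a.
by rewrite subr0 A0 A1.
Qed.

Definition center : 'rV[R]_3 := point3 0 1 ord_max d d (1 - (d + d)).

(** On a triangle where h is a sum of edge functions, these are transferred;
    elsewhere a single value is placed at the center. *)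
Definition triangle_value h s : R :=
  match pselect (exists A, decomposes h A) with
  | left hA => \sum_l projT1 (cid hA) l (tau (s 0 l))
  | right _ => if s == center then h c0 else 0
  end.

Lemma triangle_valueE h A s : decomposes h A ->
  triangle_value h s = \sum_l A l (tau (s 0 l)).
Proof.
move=> hA; rewrite /triangle_value; case: pselect => [p|[]]; last by exists A.
apply: eq_bigr => l _.
exact: decomposes_unique (projT2 (cid p)) hA _ _ (tau_ge0 _) (tau_le1 _).
Qed.

Lemma decomposesN h h' A : (forall s, simplex s -> h' s = - h s) ->
  decomposes h A -> decomposes h' (fun l a => - A l a).
Proof.
move=> hh [At [i Ai] hA]; split; first by move=> l; apply: tameN.
  by exists i => a; rewrite Ai oppr0.
by move=> s sS; rewrite hh // hA // sumrN.
Qed.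

Lemma triangle_valueN h h' s : (forall r, simplex r -> h' r = - h r) ->
  triangle_value h' s = - triangle_value h s.
Proof.
move=> hh; have [[A hA]|nA] := pselect (exists A, decomposes h A).
  by rewrite (triangle_valueE _ (decomposesN hh hA)) (triangle_valueE _ hA)
    sumrN.
rewrite /triangle_value; case: pselect => [[A hA]|_].
  case: nA; exists (fun l a => - A l a); apply: decomposesN hA => r rS.
  by rewrite hh // opprK.
case: pselect => [//|_]; case: eqP => _; last by rewrite oppr0.
exact: hh.
Qed.

Lemma triangle_value_zero h s : (forall r, simplex r -> h r = 0) ->
  triangle_value h s = 0.
Proof.
move=> h0; rewrite (@triangle_valueE _ (fun _ _ => 0)); first by rewrite big1.
split; [by move=> _; exact: tame0 | by exists 0|].
by move=> r rS; rewrite h0 // big1.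
Qed.

(** On an edge, either the point of the new parameters is moved to that of the
    old ones, or the argument of h is 0, where h vanishes. *)
Definition local_value h s : R :=
  if [exists l, s 0 l == 0] then h (\row_l tau (s 0 l)) else triangle_value h s.

Definition interior s := forall l, s 0 l != 0.

Lemma local_value_interior h s : interior s ->
  local_value h s = triangle_value h s.
Proof. by move=> sI; rewrite /local_value; case: existsP => // -[l];
  rewrite (negPf (sI l)). Qed.

Lemma local_value_edge i j k h s : uniq [:: i; j;
  k] -> triangle_function h -> simplex s ->
  s 0 k = 0 -> local_value h s = h (point3 i j k (tau (s 0 i)) (1 - tau (s 0
    i)) 0).
Proof.
move=> u [_ hv h0] sS sk; rewrite /local_value.
have -> : [exists l, s 0 l == 0] by apply/existsP; exists k; rewrite sk.
have sj : s 0 j = 1 - s 0 i by have := simplex_sum u sS; lra.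
have [tr|[tj ti]] := tau_rev (s 0 i).
  congr h; apply: (eq_point3 u); rewrite mxE ?sj ?tr ?sk //; exact: tau0.
rewrite ti subr0; have [_ -> _] := point3_vertex R i j k; rewrite hv.
suff -> : \row_l tau (s 0 l) = 0 by [].
by apply/rowP; apply: (ord3P u); rewrite !mxE ?ti ?sj ?tj ?sk ?tau0.
Qed.

Lemma local_value_vertex h i : triangle_function h ->
  local_value h (vertex R i) = 0.
Proof.
move=> ph; have [_ hv _] := ph; have [j [k u]] := ord3_others i.
rewrite (local_value_edge u ph (simplex_vertex _ i)) !vertexE.
  by rewrite eqxx tau1 subr0; have [_ -> _] := point3_vertex R i j k.
move: u; rewrite /= !inE negb_or => /and3P[/andP[_ /negPf ik] _ _].
by rewrite eq_sym ik.
Qed.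

Lemma interior_or_edge s : interior s \/ exists i j k, uniq [:: i; j;
  k] /\ s 0 k = 0.
Proof.
have [/existsP[k /eqP sk]|/existsPn sI] := boolP [exists k, s 0 k == 0].
  right; have [i [j u]] := ord3_others k; exists i, j, k; split=> //.
  by have := rot_uniq 1 [:: k; i; j]; rewrite u.
by left.
Qed.

(** r stays in the face of the simplex whose relative interior contains s. *)
Definition supports s r := forall l, s 0 l = 0 -> r 0 l = 0.

Lemma interior_supports s r : interior s -> supports s r.
Proof. by move=> sI l /eqP; rewrite (negPf (sI l)). Qed.

Lemma edge_supports i j k s r : uniq [:: i; j; k] -> simplex s ->
  (forall l, s 0 l < 1) -> s 0 k = 0 -> r 0 k = 0 -> supports s r.
Proof.
move=> u sS s1 sk rk; have := simplex_sum u sS; have := s1 i; have := s1 j.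
by move=> sj si sum; apply: (ord3P u) => //; lra.
Qed.

(** The equation on the product of the closed cells of three points in triangles
    of one orientation; [opposite_relation] is the case where the third triangle
    has the other orientation. *)
Definition same_relation hx hy hw s s' s'' := forall r r' r'',
  simplex r -> simplex r' -> simplex r'' ->
  supports s r -> supports s' r' -> supports s'' r'' ->
  (forall l, r 0 l + r' 0 l + r'' 0 l = s 0 l + s' 0 l + s'' 0 l) ->
  hx r + hy r' + hw r'' = 0.

Lemma same_relation_rot hx hy hw s s' s'' :
  same_relation hx hy hw s s' s'' -> same_relation hy hw hx s' s'' s.
Proof.
move=> rel r r' r'' rS rS' rS'' sr sr' sr'' rl; rewrite addrC addrA.
by apply: rel => // l; have := rl l; lra.
Qed.

Definition nonvertex s := simplex s /\ forall l, s 0 l < 1.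

(** With all column sums equal to 1, the values of the transferred function add
    up to zero, whether the rows are interior or on edges. *)
Section SameOrientation.
Variables (hx hy hw : 'rV[R]_3 -> R) (s s' s'' : 'rV[R]_3).
Hypotheses (px : triangle_function hx) (py : triangle_function hy) (pw :
  triangle_function hw).
Hypotheses (ps : nonvertex s) (ps' : nonvertex s') (ps'' : nonvertex s'').
Hypothesis rel : same_relation hx hy hw s s' s''.
Hypothesis sum1 : forall l, s 0 l + s' 0 l + s'' 0 l = 1.

Lemma local_sum_triangles : interior s -> interior s' -> interior s'' ->
  local_value hx s + local_value hy s' + local_value hw s'' = 0.
Proof.
move=> sI sI' sI''; rewrite !local_value_interior //.
have [r r' r'' rS rS' rS'' rl|x0 y0 w0] := triangles_same_zero px py pw.
  apply: rel => //; try exact: interior_supports.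
  by move=> l; rewrite rl sum1.
by rewrite !triangle_value_zero // !addr0.
Qed.

Lemma local_sum_edge_triangles i j k : uniq [:: i; j; k] -> s 0 k = 0 ->
    interior s' -> interior s'' ->
  local_value hx s + local_value hy s' + local_value hw s'' = 0.
Proof.
move=> u sk sI' sI''; have [sS s1] := ps; have [sS' _] := ps';
  have [sS'' _] := ps''.
have rel' r r' r'' : simplex r -> simplex r' -> simplex r'' -> r 0 k = 0 ->
    (forall l, r 0 l + r' 0 l + r'' 0 l = 1) -> hx r + hy r' + hw r'' = 0.
  move=> rS rS' rS'' rk rl; apply: rel => //; try exact: interior_supports.
    exact: edge_supports u sS s1 sk rk.
  by move=> l; rewrite rl sum1.
have [x0 yk wk] := edge_triangle_triangle u px py pw rel'.
have [g [gA gE]] := decomposes_depends u yk.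
have [g' [gA' gE']] := decomposes_depends u wk.
rewrite (local_value_edge u px sS sk) !local_value_interior //.
rewrite (triangle_valueE _ gA) (triangle_valueE _ gA') !(sum_assign u) !add0r.
have [tS _ _] := edge_point u (tau_ge0 (s 0 i)) (tau_le1 (s 0 i)).
rewrite x0 ?add0r //; last by have [] := point3E u (tau (s 0 i)) (1 - tau (s 0
  i)) 0.
(* On the edge the k-th coordinate is 0, so those of y and w add up to 1,
   and the relation between g and g' is an odd reflection. *)
have gt' : tame g'.
  have [/(_ k) + _ _] := gA'.
  by have [_ _ ->] := assignE u (fun=> 0 : R) (fun=> 0) g'.
have -> : s'' 0 k = 1 - s' 0 k by have := sum1 k; rewrite sk; lra.
rewrite (tame_tau_rev _ gt').
move: (tau (s' 0 k)) (tau_ge0 (s' 0 k)) (tau_le1 (s' 0 k)) => a a0 a1.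
have [E1 E2 E3] := point3E u a (1 - a) 0.
have [E1' E2' E3'] := point3E u (1 - a) 0 a.
have [E1'' E2'' E3''] := point3E u 0 a (1 - a).
have [S1 _ _] := edge_point u a0 a1.
have S2 : simplex (point3 i j k (1 - a) 0 a) by apply: simplex_point3 => //;
  lra.
have S3 : simplex (point3 i j k 0 a (1 - a)) by apply: simplex_point3 => //;
  lra.
have := rel' _ _ _ S1 S2 S3 E3; rewrite x0 // add0r gE // gE' // E3' E3'';
  apply.
by apply: (ord3P u); rewrite ?E1 ?E2 ?E3 ?E1' ?E2' ?E3' ?E1'' ?E2'' ?E3''; ring.
Qed.

Lemma local_sum_edges_triangle i j k : uniq [:: i; j; k] ->
    s 0 k = 0 -> s' 0 j = 0 -> interior s'' ->
  local_value hx s + local_value hy s' + local_value hw s'' = 0.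
Proof.
move=> u sk sj' sI''; have [sS s1] := ps; have [sS' s1'] := ps';
  have [sS'' _] := ps''.
have u' : uniq [:: i; k; j].
  by move: (u); rewrite /= !inE !negb_or (eq_sym k j) => /and3P[/andP[->
    ->] ->].
have rel' r r' r'' : simplex r -> simplex r' -> simplex r'' ->
    r 0 k = 0 -> r' 0 j = 0 ->
    (forall l, r 0 l + r' 0 l + r'' 0 l = 1) -> hx r + hy r' + hw r'' = 0.
  move=> rS rS' rS'' rk rj rl; apply: rel => //; try exact: interior_supports.
  - exact: edge_supports u sS s1 sk rk.
  - exact: edge_supports u' sS' s1' sj' rj.
  by move=> l; rewrite rl sum1.
have dw := edge_edge_triangle u px py pw rel'.
rewrite (local_value_edge u px sS sk) (local_value_edge u' py sS' sj').
rewrite local_value_interior // (triangle_valueE _ dw) (sum_assign u) add0r.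
have -> : s 0 i = s'' 0 j.
  by have := sum1 j; have := simplex_sum u sS; rewrite sk sj'; lra.
have -> : s' 0 i = s'' 0 k.
  by have := sum1 k; have := simplex_sum u sS'; rewrite sk sj'; lra.
have -> a b c : point3 i k j a b c = point3 i j k a c b :> 'rV[R]_3.
  by rewrite /point3 addrAC.
by rewrite addrACA !subrr addr0.
Qed.

(** The three edge functions satisfy a relation at corresponding parameters,
    which holds in particular at the old ones. *)
Lemma local_sum_edges i j k : uniq [:: i; j; k] ->
    s 0 k = 0 -> s' 0 j = 0 -> s'' 0 i = 0 ->
  local_value hx s + local_value hy s' + local_value hw s'' = 0.
Proof.
move=> u sk sj' si''.
have [sS s1] := ps; have [sS' s1'] := ps'; have [sS'' s1''] := ps''.
have [ij ik jk] : [/\ i != j, i != k & j != k].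
  by move: (u); rewrite /= !inE !negb_or => /and3P[/andP[-> ->] ->].
have u1 : uniq [:: i; k; j] by rewrite /= !inE !negb_or ij ik eq_sym jk.
have u2 : uniq [:: j; k; i].
  by rewrite /= !inE !negb_or jk (eq_sym j) ij (eq_sym k) ik.
have ei : s' 0 i = 1 - s 0 i by have := sum1 i; lra.
have ej : s'' 0 j = s 0 i.
  by have := sum1 j; have := simplex_sum u sS; rewrite sk sj'; lra.
rewrite (local_value_edge u px sS sk) (local_value_edge u1 py sS' sj').
rewrite (local_value_edge u2 pw sS'' si'') ei ej.
have P1 a b c : point3 i k j a b c = point3 i j k a c b :> 'rV[R]_3.
  by rewrite /point3 addrAC.
have P2 a b c : point3 j k i a b c = point3 i j k c a b :> 'rV[R]_3.
  by rewrite /point3 addrC addrA.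
have [_ _ yt] := tame_edges u py.
rewrite P1 P2 (tame_tau_rev _ yt) subKr.
move: (tau (s 0 i)) (tau_ge0 (s 0 i)) (tau_le1 (s 0 i)) => a a0 a1.
have [E1 E2 E3] := point3E u a (1 - a) 0.
have [E1' E2' E3'] := point3E u (1 - a) 0 a.
have [E1'' E2'' E3''] := point3E u 0 a (1 - a).
have [S1 S3 _] := edge_point u a0 a1.
have S2 : simplex (point3 i j k (1 - a) 0 a) by apply: simplex_point3 => //;
  lra.
apply: rel => //.
- exact: edge_supports u sS s1 sk E3.
- exact: edge_supports u1 sS' s1' sj' E2'.
- exact: edge_supports u2 sS'' s1'' si'' E1''.
apply: (ord3P u); rewrite sum1 ?E1 ?E2 ?E3 ?E1' ?E2' ?E3' ?E1'' ?E2'' ?E3'';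
  ring.
Qed.

End SameOrientation.

Lemma local_sum_same_sign hx hy hw s s' s'' :
    triangle_function hx -> triangle_function hy -> triangle_function hw ->
    nonvertex s -> nonvertex s' -> nonvertex s'' ->
    same_relation hx hy hw s s' s'' ->
    (forall l, s 0 l + s' 0 l + s'' 0 l = 1) ->
  local_value hx s + local_value hy s' + local_value hw s'' = 0.
Proof.
move=> px py pw ps ps' ps'' rel sum1.
have rot a b c : a + b + c = b + c + a :> R by lra.
have sum2 l : s' 0 l + s'' 0 l + s 0 l = 1 by have := sum1 l; lra.
have sum3' l : s'' 0 l + s 0 l + s' 0 l = 1 by have := sum1 l; lra.
have rel2 := same_relation_rot rel; have rel3 := same_relation_rot rel2.
(* Zeros of two rows in one column would force a 1, hence a vertex, in the
   third row. *)
have third r r' r'' k k' : nonvertex r'' ->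
  (forall l, r 0 l + r' 0 l + r'' 0 l = 1) ->
    r 0 k = 0 -> r' 0 k' = 0 -> exists i, uniq [:: i; k'; k].
  move=> [_ r1] rl rk rk'; have [kk|kk] := eqVneq k' k.
    by rewrite kk in rk'; have := rl k; have := r1 k; rewrite rk rk'; lra.
  have [i u] := ord3_third kk; exists i.
  by have := rot_uniq 2 [:: k'; k; i]; rewrite u /rot /= => ->.
have two h1 h2 h3 r r' r'' k k' : triangle_function h1 ->
  triangle_function h2 ->
    triangle_function h3 -> nonvertex r -> nonvertex r' -> nonvertex r'' ->
    same_relation h1 h2 h3 r r' r'' -> (forall l,
      r 0 l + r' 0 l + r'' 0 l = 1) ->
    r 0 k = 0 -> r' 0 k' = 0 -> interior r'' ->
    local_value h1 r + local_value h2 r' + local_value h3 r'' = 0.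
  move=> p1 p2 p3 q1 q2 q3 rl rs rk rk' rI.
  have [i u] := third _ _ _ _ _ q3 rs rk rk'.
  exact: local_sum_edges_triangle u rk rk' rI.
have [sI|[i [j [k [u sk]]]]] := interior_or_edge s;
have [sI'|[i' [j' [k' [u' sk']]]]] := interior_or_edge s';
have [sI''|[i'' [j'' [k'' [u'' sk'']]]]] := interior_or_edge s''.
- exact: local_sum_triangles.
- by rewrite -rot; exact: (local_sum_edge_triangles _ _ _ _ _ _ rel3 _ u'').
- by rewrite rot; exact: (local_sum_edge_triangles _ _ _ _ _ _ rel2 _ u').
- by rewrite rot; exact: (two _ _ _ _ _ _ k' k'' _ _ _ _ _ _ rel2).
- exact: (local_sum_edge_triangles _ _ _ _ _ _ rel _ u).
- by rewrite -rot; exact: (two _ _ _ _ _ _ k'' k _ _ _ _ _ _ rel3).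
- exact: (two _ _ _ _ _ _ k k' _ _ _ _ _ _ rel).
- have [l ul] := third _ _ _ _ _ ps'' sum1 sk sk'.
  have [l' ul'] := third _ _ _ _ _ ps sum2 sk' sk''.
  have [l'' ul''] := third _ _ _ _ _ ps' sum3' sk'' sk.
  have sl : s'' 0 l = 0.
    have := ord3_mem ul k''; rewrite !inE => /or3P[] /eqP kl;
      first by rewrite -kl.
      by move: ul'; rewrite kl /= !inE eqxx /= andbF.
    by move: ul''; rewrite kl /= !inE eqxx /= andbF.
  exact: (local_sum_edges _ _ _ _ _ _ rel _ ul).
Qed.

Lemma local_sum_parallel i j k hx hy hw s s' s'' : uniq [:: i; j; k] ->
    triangle_function hx -> triangle_function hy -> triangle_function hw ->
    nonvertex s -> nonvertex s' -> nonvertex s'' ->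
    same_relation hx hy hw s s' s'' ->
    s 0 k = 0 -> s' 0 k = 0 -> s'' 0 k = 0 -> s 0 i + s' 0 i + s'' 0 i = 1 ->
  local_value hx s + local_value hy s' + local_value hw s'' = 0.
Proof.
move=> u px py pw [sS s1] [sS' s1'] [sS'' s1''] rel sk sk' sk'' si.
have Z := parallel_edges_zero u px py pw.
rewrite !(local_value_edge u) //.
have edge a : 0 <= a -> a <= 1 -> [/\ hx (point3 i j k a (1 - a) 0) = 0,
    hy (point3 i j k a (1 - a) 0) = 0 & hw (point3 i j k a (1 - a) 0) = 0].
  move=> a0 a1; have [aS _ _] := edge_point u a0 a1.
  apply: Z => //; last by have [] := point3E u a (1 - a) 0.
  move=> r r' r'' rS rS' rS'' rk rk' rk'' ri; apply: rel => //.
  - exact: edge_supports u sS s1 sk rk.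
  - exact: edge_supports u sS' s1' sk' rk'.
  - exact: edge_supports u sS'' s1'' sk'' rk''.
  have := simplex_sum u sS; have := simplex_sum u sS';
    have := simplex_sum u sS''.
  have := simplex_sum u rS; have := simplex_sum u rS';
    have := simplex_sum u rS''.
  by move=> e1 e2 e3 e4 e5 e6; apply: (ord3P u); lra.
have [-> _ _] := edge _ (tau_ge0 (s 0 i)) (tau_le1 (s 0 i)).
have [_ -> _] := edge _ (tau_ge0 (s' 0 i)) (tau_le1 (s' 0 i)).
have [_ _ ->] := edge _ (tau_ge0 (s'' 0 i)) (tau_le1 (s'' 0 i)).
by rewrite !addr0.
Qed.

Definition opposite_relation hx hy hw s s' s'' := forall r r' r'',
  simplex r -> simplex r' -> simplex r'' ->
  supports s r -> supports s' r' -> supports s'' r'' ->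
  (forall l, r 0 l + r' 0 l - r'' 0 l = s 0 l + s' 0 l - s'' 0 l) ->
  hx r + hy r' + hw r'' = 0.

Lemma opposite_relationC hx hy hw s s' s'' :
  opposite_relation hx hy hw s s' s'' -> opposite_relation hy hx hw s' s s''.
Proof.
move=> rel r r' r'' rS rS' rS'' sr sr' sr'' rl; rewrite (addrC (hy r)).
by apply: rel => // l; have := rl l; lra.
Qed.

Lemma local_sum_opposite_interior i hx hy hw s s' s'' :
    triangle_function hx -> triangle_function hy -> triangle_function hw ->
    nonvertex s -> nonvertex s' -> nonvertex s'' ->
    opposite_relation hx hy hw s s' s'' ->
    (forall l, s 0 l + s' 0 l - s'' 0 l = (l == i)%:R) ->
    interior s' -> interior s'' ->
  local_value hx s + local_value hy s' + local_value hw s'' = 0.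
Proof.
move=> px py pw [sS s1] [sS' s1'] [sS'' s1''] rel sum1 sI' sI''.
have [sI|[a [b [k [uk sk]]]]] := interior_or_edge s.
  rewrite !local_value_interior //.
  have [r r' r'' rS rS' rS'' rl|x0 y0 w0] := @triangles_opposite_zero _ i _ _ _
    px py pw.
    apply: rel => //; try exact: interior_supports.
    by move=> l; rewrite rl sum1.
  by rewrite !triangle_value_zero // !addr0.
have ik : i != k.
  apply/eqP => ik; have := sum1 i; rewrite -ik in sk; rewrite eqxx sk /=.
  by have := s1' i; have := sS''.1 i; lra.
have [j u'] := ord3_third ik.
have u : uniq [:: i; j; k].
  by move: u'; rewrite /= !inE !negb_or (eq_sym k j) => /and3P[/andP[-> ->] ->].
have ki : (k == i) = false by rewrite eq_sym (negPf ik).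
have rel' r r' r'' : simplex r -> simplex r' -> simplex r'' -> r 0 k = 0 ->
    (forall l, r 0 l + r' 0 l - r'' 0 l = (l == i)%:R) ->
      hx r + hy r' + hw r'' = 0.
  move=> rS rS' rS'' rk rl; apply: rel => //; try exact: interior_supports.
    exact: edge_supports u sS s1 sk rk.
  by move=> l; rewrite rl sum1.
have [x0 yk wk] := edge_triangle_opposite u px py pw rel'.
have [g [gA gE]] := decomposes_depends u yk.
have [g' [gA' gE']] := decomposes_depends u wk.
rewrite (local_value_edge u px sS sk) !local_value_interior //.
rewrite (triangle_valueE _ gA) (triangle_valueE _ gA') !(sum_assign u) !add0r.
have [tS _ _] := edge_point u (tau_ge0 (s 0 i)) (tau_le1 (s 0 i)).
rewrite x0 ?add0r //; last by have [] := point3E u (tau (s 0 i)) (1 - tau (s 0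
  i)) 0.
have -> : s'' 0 k = s' 0 k by have := sum1 k; rewrite sk ki /=; lra.
move: (tau (s' 0 k)) (tau_ge0 (s' 0 k)) (tau_le1 (s' 0 k)) => c c0' c1.
have [E1 E2 E3] := point3E u c (1 - c) 0.
have [E1' E2' E3'] := point3E u (1 - c) 0 c.
have [E1'' E2'' E3''] := point3E u 0 (1 - c) c.
have [S1 _ _] := edge_point u c0' c1.
have S2 : simplex (point3 i j k (1 - c) 0 c) by apply: simplex_point3 => //;
  lra.
have S3 : simplex (point3 i j k 0 (1 - c) c) by apply: simplex_point3 => //;
  lra.
have ji : (j == i) = false.
  by move: u; rewrite /= !inE negb_or eq_sym => /and3P[/andP[/negPf -> _] _ _].
have := rel' _ _ _ S1 S2 S3 E3; rewrite x0 // add0r gE // gE' // E3' E3'';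
  apply.
by apply: (ord3P u); rewrite ?E1 ?E2 ?E3 ?E1' ?E2' ?E3' ?E1'' ?E2'' ?E3'' ?eqxx
  ?ji ?ki /=; ring.
Qed.

(** The columns s + s' - s'' are integers in [0, 1] with total 1, so exactly
    one of them is 1.  The rows x and y are not both on edges, which is all
    that is needed since that case can be rewritten with a common
    orientation. *)
Lemma local_sum_opposite hx hy hw s s' s'' :
    triangle_function hx -> triangle_function hy -> triangle_function hw ->
    nonvertex s -> nonvertex s' -> nonvertex s'' ->
    opposite_relation hx hy hw s s' s'' ->
    (forall l, s 0 l + s' 0 l - s'' 0 l \is a Num.int) ->
    interior s \/ interior s' -> interior s'' ->
  local_value hx s + local_value hy s' + local_value hw s'' = 0.
Proof.
move=> px py pw ps ps' ps'' rel sint sI sI''.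
have [[sS s1] [sS' s1'] [sS'' s1'']] := And3 ps ps' ps''.
have lo l : 0 <= s 0 l + s' 0 l - s'' 0 l.
  rewrite -int_lt_addr1 ?rpred0 //.
  by have := sS.1 l; have := sS'.1 l; have := s1'' l; lra.
have hi l : s 0 l + s' 0 l - s'' 0 l <= 1.
  rewrite -int_lt_addr1 ?rpred1 //.
  by have := s1 l; have := s1' l; have := sS''.1 l; lra.
have c01 l : s 0 l + s' 0 l - s'' 0 l != 0 -> s 0 l + s' 0 l - s'' 0 l = 1.
  move=> c0'; apply/eqP; rewrite eq_le hi /= -int_lt_addr1 ?rpred1 //.
  by rewrite ltrDr lt_neqAle eq_sym c0' lo.
have [i ci] : exists i, s 0 i + s' 0 i - s'' 0 i != 0.
  apply/existsP; rewrite -negb_forall; apply/negP => /forallP z.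
  have [j [k u]] := ord3_others 0.
  have := simplex_sum u sS; have := simplex_sum u sS';
    have := simplex_sum u sS''.
  by have /eqP := z 0; have /eqP := z j; have /eqP := z k; lra.
have sum1 l : s 0 l + s' 0 l - s'' 0 l = (l == i)%:R.
  have [j [k u]] := ord3_others i; have ci1 := c01 i ci.
  have := simplex_sum u sS; have := simplex_sum u sS';
    have := simplex_sum u sS''.
  have := lo j; have := lo k => lk lj e1 e2 e3.
  move: (u); rewrite /= !inE negb_or => /and3P[/andP[/negPf ij /negPf ik] _ _].
  by move: l; apply: (ord3P u); rewrite ?eqxx ?(eq_sym _ i) ?ij ?ik /=; lra.
case: sI => sI; last exact: (@local_sum_opposite_interior i).
rewrite [local_value hx s + _]addrC.
apply: (@local_sum_opposite_interior i) => //; first exact: opposite_relationC.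
by move=> l; have := sum1 l; lra.
Qed.

End Transfer.

(** * Tight triples and their faces *)

Section Faces.
Variables (R : realType) (P : 'rV[R]_3 -> R) (F : 'rV[R]_3).
Hypothesis Paff : cellwise_affine P.
Hypothesis P_ge1 : forall x y w, plane x -> plane y -> plane w ->
  x + y + w = F -> 1 <= P x + P y + P w.
Implicit Types x y w : 'rV[R]_3.

Definition tight x y w :=
  [/\ plane x, plane y, plane w, x + y + w = F & P x + P y + P w = 1].

Lemma tight_rot x y w : tight x y w -> tight y w x.
Proof.
by move=> [x0 y0 w0 xyw p]; split; rewrite // addrC addrA.
Qed.

(** The point a is relatively interior to its cell, so the segment from b can be
    prolonged a little beyond a. *)
Lemma same_cell_extend (a b : R) : same_cell a b -> exists2 t0 : R, 0 < t0 &
  forall t, 0 <= t -> t <= t0 -> same_cell a (a + t * (a - b)).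
Proof.
move=> ab; have [ai|ai] := boolP (a \is a Num.int).
  exists 1 => // t _ _; rewrite (same_cell_int ai ab) subrr mulr0 addr0.
  exact: same_cell_refl.
have [k [ki ka ak]] := int_floor a.
have {}ka : k < a by rewrite lt_neqAle ka andbT; apply: contra ai => /eqP <-.
have k1i : k + 1 \is a Num.int by rewrite rpredD ?rpred1.
have kb : k <= b by apply: (ab k ki).1; exact: ltW.
have bk : b <= k + 1 by apply: (ab _ k1i).2; exact: ltW.
exists (Num.min (a - k) (k + 1 - a)).
  by rewrite lt_min !subr_gt0 ka.
move=> t t0; rewrite le_min => /andP[t1 t2].
apply: (same_cell_open ki) => //.
  have : t * (b - a) <= t * 1 by rewrite ler_wpM2l //; lra.
  lra.
have : t * (a - b) <= t * 1 by rewrite ler_wpM2l //; lra.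
lra.
Qed.

Lemma affine_extend x y : plane x -> plane y -> cell x y ->
  exists2 t0 : R, 0 < t0 &
  forall t, 0 <= t -> t <= t0 -> P (x + t *: (x - y)) = P x + t * (P x - P y).
Proof.
move=> x0 y0 xy; have [c [b E]] := Paff x0.
have [t1 t10 H1] := same_cell_extend (xy 0).
have [t2 t20 H2] := same_cell_extend (xy 1).
have [t3 t30 H3] := same_cell_extend (xy ord_max).
exists (Num.min t1 (Num.min t2 t3)); first by rewrite !lt_min t10 t20.
move=> t t0; rewrite !le_min => /and3P[tt1 tt2 tt3].
have cxt : cell x (x + t *: (x - y)).
  by move=> l; rewrite !mxE; move: l; apply: (ord3P uniq3);
    [exact: H1|exact: H2|exact: H3].
have pxt : plane (x + t *: (x - y)) by apply/planeD/planeZ/planeB.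
rewrite (E _ pxt cxt) (E _ x0 (fun=> @same_cell_refl _ _)) (E _ y0 xy).
by rewrite !(sum3 uniq3) !mxE; ring.
Qed.

(** On the product of the cells of x, y, w the sum of P is affine and at least
    1, and it is 1 at a relatively interior point; hence it is constant. *)
Lemma tight_face x y w x' y' w' : tight x y w -> plane x' -> plane y' ->
  plane w' ->
  cell x x' -> cell y y' -> cell w w' -> x' + y' + w' = F -> tight x' y' w'.
Proof.
move=> [x0 y0 w0 xyw p1] x0' y0' w0' cx cy cw xyw'; split=> //.
have [tx tx0 Hx] := affine_extend x0 x0' cx.
have [ty ty0 Hy] := affine_extend y0 y0' cy.
have [tw tw0 Hw] := affine_extend w0 w0' cw.
pose t := Num.min tx (Num.min ty tw).
have t0 : 0 < t by rewrite !lt_min tx0 ty0.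
have [ttx tty ttw] : [/\ t <= tx, t <= ty & t <= tw].
  by rewrite /t !ge_min !lexx !orbT.
have := @P_ge1 (x + t *: (x - x')) (y + t *: (y - y')) (w + t *: (w - w')).
rewrite Hx ?Hy ?Hw // ?(ltW t0) //.
have -> : x + t *: (x - x') + (y + t *: (y - y')) + (w + t *: (w - w')) = F.
  rewrite -[RHS]addr0 -(scaler0 _ t) -(subrr F) -{1}xyw -{1}xyw -xyw'.
  by apply/rowP => i; rewrite !mxE; ring.
have ge1 := P_ge1 x0' y0' w0' xyw'.
move=> /(_ _ _ _ erefl) H; apply/eqP; rewrite eq_le ge1 andbT.
have {}H := H (planeD x0 (planeZ _ (planeB x0 x0')))
  (planeD y0 (planeZ _ (planeB y0 y0'))) (planeD w0 (planeZ _ (planeB w0 w0'))).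
have tp : t * (P x + P y + P w) = t by rewrite p1 mulr1.
have : t * (P x' + P y' + P w' - 1) <= 0 by move: H p1 tp; lra.
by rewrite pmulr_rle0 // subr_le0.
Qed.

End Faces.

(** * The transferred solution *)

Section Representation.
Variable R : realType.
Implicit Types (e : R) (x y n s r : 'rV[R]_3).

Lemma barycentric_nonvertex x e n s : barycentric x e n s -> ~ integral x ->
  nonvertex s.
Proof.
move=> B xi; split; first by case: B.
by move=> l; exact: simplex_lt1 B xi.
Qed.

Lemma barycentric_sum x e n s : barycentric x e n s -> plane x ->
  \sum_i n 0 i = - e.
Proof.
move=> [_ _ [_ s1] ->]; rewrite /plane.
under eq_bigr do rewrite mxE [X in _ + X]mxE.
rewrite big_split -mulr_sumr /= s1 mulr1 => /eqP.
by rewrite addr_eq0 => /eqP.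
Qed.

Lemma barycentric_plane x e n s r : barycentric x e n s -> plane x ->
  simplex r -> plane (n + e *: r).
Proof.
move=> B x0 [_ r1]; rewrite /plane.
under eq_bigr do rewrite mxE [X in _ + X]mxE.
by rewrite big_split -mulr_sumr /= r1 mulr1 (barycentric_sum B x0) addNr.
Qed.

Lemma barycentric_cell_supports x e n s r : barycentric x e n s ->
  ~ integral x -> simplex r -> supports s r -> cell x (n + e *: r).
Proof.
move=> B xi rS sr l; have [eS ni sS xE] := B.
rewrite {1}xE !mxE; have [sl|sl] := eqVneq (s 0 l) 0.
  by rewrite sl (sr l sl); exact: same_cell_refl.
have s0 : 0 < s 0 l by rewrite lt_neqAle eq_sym sl sS.1.
have s1 := simplex_lt1 l B xi; have r0 := rS.1 l; have r1 := simplex_le1 l rS.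
case: eS => ->.
  by apply: (@same_cell_open _ (n 0 l)) => //; lra.
by apply: (@same_cell_open _ (n 0 l - 1)); rewrite ?rpredB ?rpred1 //; lra.
Qed.

Lemma integral_sign e x : sign e -> integral x -> integral (e *: x).
Proof. by case=> -> xi l; rewrite mxE rpredM ?rpredN ?rpred1. Qed.

Lemma integral_vertex i : integral (vertex R i).
Proof. by move=> l; rewrite vertexE rpred_nat. Qed.

Lemma cell_reflect x y z : integral z -> cell x y -> cell (z - x) (z - y).
Proof.
by move=> zi xy l; rewrite !mxE; apply: same_cellDl => //; exact: same_cellN.
Qed.

(** On an edge both orientations are available. *)
Lemma barycentric_flip i j k x e n s : uniq [:: i; j; k] ->
    barycentric x e n s -> s 0 k = 0 ->
  exists n' s', barycentric x (- e) n' s'.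
Proof.
move=> u [eS ni sS ->] sk.
have ss := simplex_sum u sS; have si := sS.1 i; have sj := sS.1 j.
exists (n + e *: point3 i j k 1 1 0), (point3 i j k (1 - s 0 i) (1 - s 0 j) 0).
have [E1 E2 E3] := point3E u 1 1 (0 : R).
have [E1' E2' E3'] := point3E u (1 - s 0 i) (1 - s 0 j) 0.
split.
- by case: eS => ->; [right|left; rewrite opprK].
- apply: integralD => //; apply: integral_sign => //.
  by apply: (ord3P u); rewrite ?E1 ?E2 ?E3 ?rpred0 ?rpred1.
- by apply: simplex_point3 => //; lra.
rewrite scaleNr -addrA -scalerBr; congr (_ + _ *: _).
apply/rowP; apply: (ord3P u); rewrite [RHS]mxE [X in _ + X]mxE;
  rewrite ?E1 ?E2 ?E3 ?E1' ?E2' ?E3' ?sk; ring.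
Qed.

End Representation.

Section Psi.
Variables (R : realType) (m : nat) (m3 : (3 <= m)%N).
Variables (t0 : R) (t0_ge0 : 0 <= t0) (t0_le1 : t0 <= 1).
Variables (c0 : 'rV[R]_3) (c0S : simplex c0).
Variable Phi : 'rV[R]_3 -> R.
Hypothesis Phi_integral : forall z, integral z -> Phi z = 0.
Hypothesis Phi_bounded : exists M, forall x, `|Phi x| <= M.
Implicit Types (e : R) (x y w n s r : 'rV[R]_3).

Local Notation d := (m%:R^-1 : R).
Local Notation value := (local_value m t0 c0).

Definition on_triangle e n : 'rV[R]_3 -> R := fun r => Phi (n + e *: r).

Lemma on_triangleP e n : sign e -> integral n ->
  triangle_function (on_triangle e n).
Proof.
move=> eS ni; have [M PM] := Phi_bounded.
split; first by exists M => s _; exact: PM.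
  move=> i; apply/Phi_integral/integralD => //; apply: integral_sign => //.
  exact: integral_vertex.
by rewrite /on_triangle scaler0 addr0 Phi_integral.
Qed.

(** The choice does not matter by [local_value_unique]. *)
Definition psi x : R := xget 0
  [set v | exists e n s, barycentric x e n s /\ v = value (on_triangle e n)
    s]%classic.

(** Only vertices and points of edges have several representations.  At a vertex
    the value is 0, and on an edge it is that of Phi at the moved point, which
    does not depend on the orientation by [tau_rev]. *)
Lemma local_value_unique x e n s e' n' s' :
    barycentric x e n s -> barycentric x e' n' s' ->
  value (on_triangle e n) s = value (on_triangle e' n') s'.
Proof.
have [xi|xi] := pselect (integral x).
  move=> B B'; have [eS ni _ _] := B; have [eS' ni' _ _] := B'.
  have [i ->] := barycentric_integral B xi.
  have [i' ->] := barycentric_integral B' xi.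
  by rewrite !(local_value_vertex m3) //; exact: on_triangleP.
suff opp p t p' t' : barycentric x 1 p t -> barycentric x (-1) p' t' ->
    value (on_triangle 1 p) t = value (on_triangle (-1) p') t'.
  move=> B B'; have [[] eE _ _ _] := B; have [[] eE' _ _ _] := B'; subst e e'.
  - by have [-> ->] := barycentric_same_sign xi B B'.
  - exact: opp.
  - by apply/esym/opp.
  - by have [-> ->] := barycentric_same_sign xi B B'.
move=> B B'.
have [i [j [k [[u tk tk' ti tj] [mk mi mj]]]]] := barycentric_opposite xi B B'.
have [eS pi tS _] := B; have [eS' pi' tS' _] := B'.
rewrite (local_value_edge m3 t0 c0 u (on_triangleP eS pi) tS tk).
rewrite (local_value_edge m3 t0 c0 u (on_triangleP eS' pi') tS' tk') ti.
have -> : t 0 j = 1 - t 0 i by have := simplex_sum u tS; lra.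
have [tr|[-> ->]] := tau_rev m3 t0 (t 0 i); last first.
  rewrite subr0; have [_ -> _] := point3_vertex R i j k.
  have [_ hv _] := on_triangleP eS pi; have [_ hv' _] := on_triangleP eS' pi'.
  by rewrite hv hv'.
rewrite tr subKr /on_triangle; congr Phi.
have [E1 E2 E3] := point3E u (tau m t0 (t 0 i)) (1 - tau m t0 (t 0 i)) 0.
have [E1' E2' E3'] := point3E u (1 - tau m t0 (t 0 i)) (tau m t0 (t 0 i)) 0.
by apply/rowP; apply: (ord3P u); rewrite [LHS]mxE [RHS]mxE [X in _ + X = _]mxE
  [X in _ = _ + X]mxE ?E1 ?E2 ?E3 ?E1' ?E2' ?E3' ?mk ?mi ?mj; lra.
Qed.

Lemma psiE x e n s : barycentric x e n s -> psi x = value (on_triangle e n) s.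
Proof.
move=> B; rewrite /psi; case: xgetP => [v _ [e' [n' [s' [B' ->]]]]|].
  exact: local_value_unique B' B.
by move=> /(_ (value (on_triangle e n) s)) /= []; exists e, n, s.
Qed.

Lemma psi_integral x : plane x -> integral x -> psi x = 0.
Proof.
move=> x0 xi; have [e [n [eS ni H]]] := barycentric_cell x0.
have B := H x x0 (fun=> @same_cell_refl _ _).
rewrite (psiE B); have [i ->] := barycentric_integral B xi.
by rewrite (local_value_vertex m3) //; exact: on_triangleP.
Qed.

Lemma psi_periodic x z : plane x -> integral z ->
  (forall y, Phi (y + z) = Phi y) -> psi (x + z) = psi x.
Proof.
move=> x0 zi Pz; have [e [n [eS ni H]]] := barycentric_cell x0.
have B := H x x0 (fun=> @same_cell_refl _ _); set s := e *: (x - n) in B.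
have B' : barycentric (x + z) e (n + z) s.
  have [_ _ sS xE] := B; split=> //; first exact: integralD.
  by rewrite {1}xE addrAC.
rewrite (psiE B) (psiE B'); congr value; apply/funext => r.
by rewrite /on_triangle addrAC Pz.
Qed.

Variables (P : 'rV[R]_3 -> R) (F : 'rV[R]_3).
Hypothesis Paff : cellwise_affine P.
Hypothesis P_ge1 : forall x y w, plane x -> plane y -> plane w ->
  x + y + w = F -> 1 <= P x + P y + P w.
Hypothesis F_integral : integral F.
Hypothesis Phi_tight : forall x y w, tight P F x y w ->
  Phi x + Phi y + Phi w = 0.

Lemma rows_relation x y w e1 n s e2 n' s' e3 n'' s'' r r' r'' :
    tight P F x y w -> barycentric x e1 n s -> barycentric y e2 n' s' ->
    barycentric w e3 n'' s'' -> ~ integral x -> ~ integral y -> ~ integral w ->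
    simplex r -> simplex r' -> simplex r'' ->
    supports s r -> supports s' r' -> supports s'' r'' ->
    e1 *: r + e2 *: r' + e3 *: r'' = e1 *: s + e2 *: s' + e3 *: s'' ->
  on_triangle e1 n r + on_triangle e2 n' r' + on_triangle e3 n'' r'' = 0.
Proof.
move=> T B B' B'' xi yi wi rS rS' rS'' sr sr' sr'' rl.
have [x0 y0 w0 xyw _] := T; apply: Phi_tight.
apply: (tight_face Paff P_ge1 T).
- exact: barycentric_plane B x0 rS.
- exact: barycentric_plane B' y0 rS'.
- exact: barycentric_plane B'' w0 rS''.
- exact: barycentric_cell_supports B xi rS sr.
- exact: barycentric_cell_supports B' yi rS' sr'.
- exact: barycentric_cell_supports B'' wi rS'' sr''.
rewrite -xyw; have [_ _ _ ->] := B; have [_ _ _ ->] := B';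
  have [_ _ _ ->] := B''.
have sumE (a b c a' b' c' : 'rV[R]_3) :
  a + a' + (b + b') + (c + c') = a + b + c + (a' + b' + c').
  by rewrite (addrACA a) (addrACA (a + b)).
by rewrite !sumE rl.
Qed.

(** The equation says that Phi is odd under the reflection through (F - w) / 2,
    which maps the cell of x to that of y; the transfer commutes with it. *)
Lemma psi_tight_vertex x y w : tight P F x y w -> integral w ->
  psi x + psi y + psi w = 0.
Proof.
move=> T wi; have [x0 y0 w0 xyw _] := T; rewrite (psi_integral w0 wi) addr0.
have yE : y = F - w - x by rewrite -xyw addrK [x + y]addrC addrK.
have ci : integral (F - w) by exact: integralB.
have [xi|xi] := pselect (integral x).
  by rewrite !psi_integral ?addr0 // yE; exact: integralB.
have [e [n [eS ni H]]] := barycentric_cell x0.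
have B := H x x0 (fun=> @same_cell_refl _ _); set s := e *: (x - n) in B.
have [_ _ sS xE] := B; have [_ s1] := barycentric_nonvertex B xi.
have B' : barycentric y (- e) (F - w - n) s.
  split=> //; first by case: eS => ->; [right|left; rewrite opprK].
    exact: integralB.
  by rewrite yE scaleNr {1}xE opprD addrA.
have opp r : simplex r -> supports s r ->
    on_triangle (- e) (F - w - n) r = - on_triangle e n r.
  move=> rS sr; have rE : F - w - n + - e *: r = F - w - (n + e *: r).
    by rewrite scaleNr opprD addrA.
  have cxr := barycentric_cell_supports B xi rS sr.
  have pxr := barycentric_plane B x0 rS.
  apply/eqP; rewrite -addr_eq0 addrC /on_triangle rE.
  suff : Phi (n + e *: r) + Phi (F - w - (n + e *: r)) + Phi w = 0.
    by rewrite (Phi_integral wi) addr0 => /eqP.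
  apply: Phi_tight; apply: (tight_face Paff P_ge1 T) => //.
  - by rewrite -xyw addrK; apply: planeB => //; exact: planeD.
  - by rewrite yE; exact: cell_reflect.
  - by rewrite subrKC subrK.
rewrite (psiE B) (psiE B'); apply/eqP; rewrite addrC addr_eq0; apply/eqP.
have [sI|[i [j [k [u sk]]]]] := interior_or_edge s.
  rewrite !local_value_interior // (@triangle_valueN _ _ _ t0_ge0 t0_le1 _ c0S
    (on_triangle e n)) //.
  by move=> r rS; apply: opp => //; exact: interior_supports.
have eS' : sign (- e) by case: B'.
have cni : integral (F - w - n) by exact: integralB.
rewrite (local_value_edge m3 t0 c0 u (on_triangleP eS ni) sS sk).
rewrite (local_value_edge m3 t0 c0 u (on_triangleP eS' cni) sS sk).
have [tS _ _] := edge_point u (tau_ge0 m t0_ge0 t0_le1 (s 0 i)) (tau_le1 m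
  t0_ge0 t0_le1 (s 0 i)).
apply: opp => //; apply: (edge_supports u sS s1 sk).
by have [] := point3E u (tau m t0 (s 0 i)) (1 - tau m t0 (s 0 i)) 0.
Qed.

Definition has_sign x e := exists n s, barycentric x e n s.

Lemma has_sign1N1 x : plane x -> has_sign x 1 \/ has_sign x (-1).
Proof.
move=> x0; have [e [n [eS ni H]]] := barycentric_cell x0.
have B := H x x0 (fun=> @same_cell_refl _ _).
by case: eS => eE; subst e; [left|right]; exists n; eexists; exact: B.
Qed.

Lemma no_flip_interior x e n s : barycentric x e n s -> ~ has_sign x (- e) ->
  interior s.
Proof.
move=> B nx; have [//|[i [j [k [u sk]]]]] := interior_or_edge s.
have [n' [s' B']] := barycentric_flip u B sk.
by case: nx; exists n', s'.
Qed.

(** The column sums are integers below 3 with total 3: all are 1, or one is 0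
    and then the three points lie on parallel edges. *)
Lemma psi_tight_same_sign x y w e : tight P F x y w ->
    ~ integral x -> ~ integral y -> ~ integral w ->
    has_sign x e -> has_sign y e -> has_sign w e ->
  psi x + psi y + psi w = 0.
Proof.
move=> T xi yi wi [n [s B]] [n' [s' B']] [n'' [s'' B'']].
have [eS ni sS xE] := B; have [_ ni' sS' yE] := B';
  have [_ ni'' sS'' wE] := B''.
have [ps ps' ps''] := And3 (barycentric_nonvertex B xi) (barycentric_nonvertex
  B' yi)
  (barycentric_nonvertex B'' wi).
have rel : same_relation (on_triangle e n) (on_triangle e n') (on_triangle e
  n'') s s' s''.
  move=> r r' r'' rS rS' rS'' sr sr' sr'' rl.
  apply: (rows_relation T B B' B'' xi yi wi rS rS' rS'' sr sr' sr'').
  rewrite -!scalerDr; congr (_ *: _); apply/rowP => l; have := rl l.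
  by rewrite !mxE.
have px := on_triangleP eS ni; have py := on_triangleP eS ni'.
have pw := on_triangleP eS ni''.
have cint l : s 0 l + s' 0 l + s'' 0 l \is a Num.int.
  have -> : s 0 l + s' 0 l + s'' 0 l =
      e * (F 0 l - n 0 l - n' 0 l - n'' 0 l).
    have [_ _ _ xyw _] := T; rewrite -xyw xE yE wE !mxE.
    by case: eS => ->; ring.
  rewrite rpredM ?rpredB //.
  by case: eS => ->; rewrite ?rpredN rpred1.
rewrite (psiE B) (psiE B') (psiE B'').
have [c1|/existsNP[k ck]] := pselect (forall l, s 0 l + s' 0 l + s'' 0 l != 0).
  apply: (local_sum_same_sign m3 t0_ge0 t0_le1 c0 px py pw ps ps' ps'' rel).
  have c_ge1 l : 1 <= s 0 l + s' 0 l + s'' 0 l.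
    rewrite -int_lt_addr1 ?rpred1 // ltrDr lt_neqAle eq_sym c1.
    by rewrite !addr_ge0 ?sS.1 ?sS'.1 ?sS''.1.
  have [i [j u]] := ord3_others 0.
  have := c_ge1 0; have := c_ge1 i; have := c_ge1 j.
  have := simplex_sum u sS; have := simplex_sum u sS';
    have := simplex_sum u sS''.
  by move=> e1 e2 e3 cj ci c0'; apply: (ord3P u); lra.
have {}ck : s 0 k + s' 0 k + s'' 0 k = 0.
  by apply/eqP; apply: contrapT => /negP; exact: ck.
have [i [j u]] := ord3_others k.
have u1 : uniq [:: i; j; k] by have := rot_uniq 1 [:: k; i; j]; rewrite u.
have u2 : uniq [:: j; i; k].
  by move: u1; rewrite /= !inE !negb_or (eq_sym j i) => /and3P[/andP[-> ->] ->].
have [sk sk' sk''] : [/\ s 0 k = 0, s' 0 k = 0 & s'' 0 k = 0].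
  by have := sS.1 k; have := sS'.1 k; have := sS''.1 k; split; lra.
have := simplex_sum u sS; have := simplex_sum u sS'; have := simplex_sum u sS''.
have := ps.2 i; have := ps'.2 i; have := ps''.2 i.
have := ps.2 j; have := ps'.2 j; have := ps''.2 j.
move=> j1 j2 j3 i1 i2 i3 e1 e2 e3.
have cij : s 0 i + s' 0 i + s'' 0 i = 1 \/ s 0 j + s' 0 j + s'' 0 j = 1.
  have ci_gt0 : 0 < s 0 i + s' 0 i + s'' 0 i by lra.
  have ci_ge1 : 1 <= s 0 i + s' 0 i + s'' 0 i.
    by rewrite -int_lt_addr1 ?rpred1 // ltrDr.
  have [->|ci] := eqVneq (s 0 i + s' 0 i + s'' 0 i) 1; first by left.
  right; apply/eqP; rewrite eq_le -!int_lt_addr1 ?rpred1 //; apply/andP; split.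
    suff : 1 < s 0 i + s' 0 i + s'' 0 i by lra.
    by rewrite lt_neqAle eq_sym ci.
  lra.
case: cij => c1.
  exact: (local_sum_parallel m3 t0_ge0 t0_le1 c0 u1 px py pw ps ps' ps'' rel).
exact: (local_sum_parallel m3 t0_ge0 t0_le1 c0 u2 px py pw ps ps' ps'' rel).
Qed.

Lemma psi_tight_opposite x y w e : tight P F x y w ->
    ~ integral x -> ~ integral y -> ~ integral w ->
    has_sign x e -> has_sign y e -> has_sign w (- e) ->
    ~ has_sign w e -> ~ (has_sign x (- e) /\ has_sign y (- e)) ->
  psi x + psi y + psi w = 0.
Proof.
move=> T xi yi wi [n [s B]] [n' [s' B']] [n'' [s'' B'']] nw nxy.
have [eS ni sS xE] := B; have [_ ni' sS' yE] := B';
  have [eS'' ni'' sS'' wE] := B''.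
have [ps ps' ps''] := And3 (barycentric_nonvertex B xi) (barycentric_nonvertex
  B' yi)
  (barycentric_nonvertex B'' wi).
rewrite (psiE B) (psiE B') (psiE B'').
apply: (local_sum_opposite m3 t0_ge0 t0_le1 c0 (on_triangleP eS ni)
  (on_triangleP eS ni') (on_triangleP eS'' ni'') ps ps' ps'').
- move=> r r' r'' rS rS' rS'' sr sr' sr'' rl.
  apply: (rows_relation T B B' B'' xi yi wi rS rS' rS'' sr sr' sr'').
  rewrite !scaleNr -!scalerDr -!scalerBr; congr (_ *: _).
  by apply/rowP => l; have := rl l; rewrite !mxE.
- move=> l; have -> : s 0 l + s' 0 l - s'' 0 l =
      e * (F 0 l - n 0 l - n' 0 l - n'' 0 l).
    have [_ _ _ xyw _] := T; rewrite -xyw xE yE wE !mxE.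
    by case: eS => ->; ring.
  rewrite rpredM ?rpredB //.
  by case: eS => ->; rewrite ?rpredN rpred1.
- have [hx|hx] := pselect (has_sign x (- e)); last by left;
  exact: no_flip_interior B hx.
  right; apply: no_flip_interior B' _ => hy.
  by apply: nxy.
- by apply: no_flip_interior B'' _; rewrite opprK.
Qed.

(** Either one point is a vertex, or a common orientation is available, or two
    points have one orientation and the third, interior to a triangle, has the
    other one. *)
Lemma psi_tight x y w : tight P F x y w -> psi x + psi y + psi w = 0.
Proof.
move=> T; have [x0 y0 w0 _ _] := T.
have rot (a b c : R) : a + b + c = b + c + a by lra.
have T2 := tight_rot T; have T3 := tight_rot T2.
have [wi|wi] := pselect (integral w); first exact: psi_tight_vertex.
have [xi|xi] := pselect (integral x); first by rewrite rot;
  exact: psi_tight_vertex.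
have [yi|yi] := pselect (integral y); first by rewrite -rot;
  exact: psi_tight_vertex.
have opp e : has_sign x e /\ has_sign y e /\ has_sign w e \/
    ~ (has_sign x e /\ has_sign y e /\ has_sign w e) by exact: EM.
have [[sx [sy sw]]|n1] := opp 1; first exact: psi_tight_same_sign sx sy sw.
have [[sx [sy sw]]|n2] := opp (-1); first exact: psi_tight_same_sign sx sy sw.
have main e : sign e -> forall a b c, tight P F a b c -> ~ integral a ->
  ~ integral b ->
    ~ integral c -> has_sign a e -> has_sign b e -> has_sign c (- e) ->
    ~ (has_sign a e /\ has_sign b e /\ has_sign c e) ->
    ~ (has_sign a (- e) /\ has_sign b (- e) /\ has_sign c (- e)) ->
    psi a + psi b + psi c = 0.
  move=> eS a b c Tabc ai bi ci ha hb hc na nb.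
  apply: (psi_tight_opposite Tabc ai bi ci ha hb hc) => [hc'|[ha' hb']].
    by apply: na.
  by apply: nb.
have s1 : sign (1 : R) by left.
have s2 : sign (-1 : R) by right.
have key e : sign e -> forall a b c, tight P F a b c -> ~ integral a ->
  ~ integral b ->
    ~ integral c -> has_sign a e -> has_sign b e -> has_sign c (- e) ->
    ~ (has_sign a 1 /\ has_sign b 1 /\ has_sign c 1) ->
    ~ (has_sign a (- 1) /\ has_sign b (- 1) /\ has_sign c (- 1)) ->
    psi a + psi b + psi c = 0.
  move=> [->|->] a b c Tabc ai bi ci ha hb hc na nb.
    by apply: (main 1).
  by apply: (main (-1)) => //; rewrite opprK.
have [hx|hx] := has_sign1N1 x0; have [hy|hy] := has_sign1N1 y0;
have [hw|hw] := has_sign1N1 w0.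
- by case: n1.
- exact: (key 1 s1 x y w).
- rewrite -rot; apply: (key 1 s1 w x y) => //; tauto.
- rewrite rot; apply: (key (-1) s2 y w x) => //; [by rewrite opprK|tauto|tauto].
- rewrite rot; apply: (key 1 s1 y w x) => //; tauto.
- rewrite -rot; apply: (key (-1) s2 w x y) => //;
  [by rewrite opprK|tauto|tauto].
- apply: (key (-1) s2 x y w) => //; by rewrite opprK.
- by case: n2.
Qed.

End Psi.

(** * From the grid to the plane *)

Section Nonvanishing.
Variables (R : realType) (m : nat) (m3 : (3 <= m)%N).
Variable Phi : 'rV[R]_3 -> R.
Hypothesis Phi_integral : forall z, integral z -> Phi z = 0.
Hypothesis Phi_bounded : exists M, forall x, `|Phi x| <= M.

Local Notation d := (m%:R^-1 : R).

(** If Phi is nonzero on an edge, its parameter is used as t0.  Otherwise the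
    triangle of x0 carries a function that vanishes on its edges but not
    identically, so it does not decompose, and x0 is used as c0. *)
Lemma psi_nonvanishing x0 : plane x0 -> Phi x0 != 0 ->
  exists t0 c0, [/\ 0 <= t0, t0 <= 1, simplex c0 &
    exists x, [/\ plane x, integral (m%:R *: x) & psi m t0 c0 Phi x != 0]].
Proof.
move=> px0 Px0; have [d0 d1] := step_bounds R m3.
have md : m%:R * d = 1.
  by rewrite mulfV // pnatr_eq0 -lt0n; apply: leq_trans m3.
have grid_point e n r : sign e -> integral n -> integral (m%:R *: r) ->
    integral (m%:R *: (n + e *: r)).
  move=> eS ni ri; rewrite scalerDr scalerA mulrC -scalerA.
  apply: integralD; last exact: integral_sign.
  by move=> l; rewrite mxE rpredM ?rpred_nat.
have grid_point3 i j k (u : uniq [:: i; j; k]) a b c : m%:R * a \is a Num.int ->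
    m%:R * b \is a Num.int -> m%:R * c \is a Num.int ->
    integral (m%:R *: point3 i j k a b c).
  move=> ai bi ci l; rewrite mxE; have [E1 E2 E3] := point3E u a b c.
  by move: l; apply: (ord3P u); rewrite ?E1 ?E2 ?E3.
have [[x [e [n [s [i [j [k [px B u sk Px]]]]]]]]|noedge] := pselect
  (exists x e n s i j k, [/\ plane x, barycentric x e n s, uniq [:: i; j; k],
     s 0 k = 0 & Phi x != 0]).
  have [eS ni sS xE] := B.
  exists (s 0 i), (vertex R 0); split; [exact: sS.1|exact: simplex_le1|
    exact: simplex_vertex|].
  have d1' : d <= 1 by lra.
  have [rS _ _] := edge_point u (ltW d0) d1'; set r := point3 _ _ _ _ _ _ in rS.
  have [E1 _ E3] := point3E u d (1 - d) 0.
  have Br : barycentric (n + e *: r) e n r by [].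
  exists (n + e *: r); split.
  - exact: barycentric_plane B px rS.
  - apply: grid_point => //; apply: grid_point3 => //.
    + by rewrite md rpred1.
    + by rewrite mulrBr md mulr1 rpredB ?rpred_nat ?rpred1.
    + by rewrite mulr0 rpred0.
  rewrite (psiE m3 (s 0 i) (vertex R 0) Phi_integral Phi_bounded Br).
  rewrite (local_value_edge m3 _ _ u (on_triangleP Phi_integral Phi_bounded eS
    ni) rS E3).
  by rewrite E1 /tau eqxx -(simplex_zero_at u sS sk) /on_triangle -xE.
have [e [n [eS ni H]]] := barycentric_cell px0.
have B := H x0 px0 (fun=> @same_cell_refl _ _); set s := e *: (x0 - n) in B.
have [_ _ sS xE] := B.
have edge0 i j k r : uniq [:: i; j; k] -> simplex r -> r 0 k = 0 ->
    on_triangle Phi e n r = 0.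
  move=> u rS rk; apply/eqP; apply: contrapT => /negP Pr; apply: noedge.
  exists (n + e *: r), e, n, r, i, j, k; split=> //.
  exact: barycentric_plane B px0 rS.
exists 0, s; split=> //.
have u : uniq [:: 0; 1; ord_max : 'I_3] by [].
have [E1 E2 E3] := point3E u d d (1 - (d + d)).
have cS : simplex (center R m) by apply: simplex_point3 => //; lra.
have Bc : barycentric (n + e *: center R m) e n (center R m) by [].
have cI : interior (center R m).
  by apply: (ord3P u); rewrite ?E1 ?E2 ?E3 gt_eqF //; lra.
exists (n + e *: center R m); split.
- exact: barycentric_plane B px0 cS.
- apply: grid_point => //; apply: grid_point3 => //; rewrite ?md ?rpred1 //.
  by rewrite mulrBr mulrDr md mulr1 rpredB ?rpredD ?rpred_nat ?rpred1.
rewrite (psiE m3 0 s Phi_integral Phi_bounded Bc) local_value_interior //.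
rewrite /triangle_value; case: pselect => [[A hA]|_]; last first.
  by rewrite eqxx /on_triangle -xE.
have [At [i Ai] hE] := hA; case/eqP: Px0.
rewrite xE -/(on_triangle Phi e n s) hE //.
have [j [k u']] := ord3_others i.
have u'' : uniq [:: i; k; j].
  by move: (u'); rewrite /= !inE !negb_or (eq_sym k j) => /and3P[/andP[->
    ->] ->].
have zero p l (v : uniq [:: i; p; l]) : A p (s 0 p) = 0.
  have p0 : 0 <= 1 - s 0 p by rewrite subr_ge0 simplex_le1.
  have p1 : 1 - s 0 p <= 1 by rewrite gerBl; exact: sS.1.
  have [rS _ _] := edge_point v p0 p1; have [F1 F2 F3] := point3E v (1 - s 0 p)
    (1 - (1 - s 0 p)) 0.
  have := hE _ rS; rewrite (edge0 _ _ _ _ v rS F3) (sum3 v) F1 F2 F3 Ai subKr.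
  by have [-> _ _] := At l; rewrite add0r addr0.
by rewrite (sum3 u') Ai (zero j k u') (zero k j u'') !addr0.
Qed.

End Nonvanishing.

Section FacetFromRestriction.
Variables (R : realType) (N : nat) (N0 : (0 < N)%N).

Lemma grid_representatives : exists reps : seq (Defs.latticeType R N),
  forall x, exists2 r, r \in reps & x - r \in integral_points R N.
Proof.
pose pt (a b : nat) : 'rV[R]_2 := \row_i ((if i == 0 then a else b)%:R / N%:R).
have NR : N%:R != 0 :> R by rewrite pnatr_eq0 -lt0n.
have ptN a b : pt a b \in lattice R N.
  by apply/forallP => i; rewrite mxE mulrCA mulfV // mulr1 rpred_nat.
exists [seq Lattice (ptN a b) | a <- iota 0 N, b <- iota 0 N] => x.
have /forallP xN := valP x.
have coord (i : 'I_2) : exists2 a : nat, (a < N)%N & val x 0 i - a%:R / N%:R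
  \is a Num.int.
  have /intrP[z xz] := xN i.
  have N0' : (0 < N%:Z)%R by [].
  have := modz_ge0 z (lt0r_neq0 N0'); have := ltz_pmod z N0'.
  move E : (z %% N)%Z => [a|a] // aN _; exists a => //.
  have -> : val x 0 i = z%:~R / N%:R by rewrite -xz mulrC mulKf.
  rewrite {1}(divz_eq z N) E intrD intrM mulrDl mulfK // addrK; exact: intr_int.
have [[a aN xa] [b bN xb]] := (coord 0, coord 1).
exists (Lattice (ptN a b)).
  by apply/allpairsP; exists (a, b); split; rewrite // mem_iota add0n.
apply/forallP => i; rewrite mul1r /=.
have -> : (lattice_val x - pt a b) 0 i = val x 0 i - pt a b 0 i.
  by rewrite [LHS]mxE [X in _ + X]mxE.
rewrite [pt a b 0 i]mxE; have [->|i0] := eqVneq i 0; first exact: xa.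
suff -> : i = 1 by [].
by case: i i0 => -[|[|]] // p _; apply: val_inj.
Qed.

Variables (f : 'rV[R]_2) (fN : f \in lattice R N) (p : 'rV[R]_2 -> R).
Hypothesis pR : regular (lattice R 1) f p.
Hypothesis pE : extreme (integral_points R N) (Lattice fN) (fun x => p (val x)).

Lemma no_grid_perturbation (k : 'rV[R]_2 -> R) :
    (forall s, s \in lattice R 1 -> k s = 0) ->
    (forall x s, x \in lattice R N -> s \in lattice R 1 -> k (x + s) = k x) ->
    (forall x y w, x + y + w = f -> p x + p y + p w = 1 ->
      k x + k y + k w = 0) ->
  forall x, x \in lattice R N -> k x = 0.
Proof.
move=> kS kper ktight x xN; have [reps repsP] := grid_representatives.
pose X : Defs.latticeType R N := Lattice xN.
apply: (@extreme_no_perturbation _ _ _ _ (fun z => p (val z)) (fun z => k (val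
  z))
  N reps (grid_regular fN pR) pE N0 _ repsP _ _ _ X).
- move=> z; rewrite integral_pointsE raddfMn /=; apply/forallP => i.
  rewrite mul1r mulmxnE -mulr_natl.
  by have /forallP := valP z.
- by move=> s; rewrite integral_pointsE; exact: kS.
- by move=> z s; rewrite integral_pointsE /= => sS; apply: kper => //;
  exact: valP.
- by move=> a b c abc; apply: ktight; rewrite -[f]/(val (Lattice fN)) -abc.
Qed.

End FacetFromRestriction.

(** Apply [no_grid_perturbation] twice: to p' - p, which then vanishes at the
    vertices, and to its transfer [psi]. *)
Lemma restriction_facet (R : realType) (q m : nat) (f : 'rV[R]_2)
    (p : 'rV[R]_2 -> R) (fq : f \in lattice R q)
    (fN : f \in lattice R (m * q)) : (0 < q)%N -> (3 <= m)%N ->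
    regular (lattice R 1) f p -> cpwl q p ->
    extreme (integral_points R (m * q)) (Lattice fN) (fun x => p (val x)) ->
  facet (lattice R 1) f p.
Proof.
move=> q0 m3 pR pq pE; split; first exact: regular_valid.
move=> p' p'v tight_sub; have p'R := tight_regular pR p'v tight_sub.
have m0 : (0 < m)%N by apply: leq_trans m3.
have N0 : (0 < m * q)%N by rewrite muln_gt0 m0.
pose k x := p' x - p x.
have [p0 pS pD pf] := pR; have [p'0 p'S p'D p'f] := p'R.
have kS s : s \in lattice R 1 -> k s = 0 by move=> sS;
  rewrite /k pS // p'S // subrr.
have kper x s : s \in lattice R 1 -> k (x + s) = k x.
  by move=> sS; rewrite /k (regularD _ pR) // (regularD _ p'R).
have ktight x y w : x + y + w = f -> p x + p y + p w = 1 -> k x + k y + k w = 0.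
  by move=> xyw p1; have := tight_triple tight_sub xyw p1; rewrite /k; lra.
have kbounded x : `|k x| <= 1.
  rewrite ler_norml /k; have := p0 x; have := p'0 x; have := pf x;
    have := p'f x.
  have := p0 (f - x); have := p'0 (f - x) => *; apply/andP; split; lra.
have kgrid : forall x, x \in lattice R (m * q) -> k x = 0.
  by apply: (no_grid_perturbation N0 pR pE) => // x s _; exact: kper.
suff k0 x : k x = 0 by apply/funext => x; apply/eqP; rewrite -subr_eq0;
  apply/eqP/k0.
have [//|kx] := eqVneq (k x) 0.
pose Phi y := k (from_plane q y).
have qR : q%:R != 0 :> R by rewrite pnatr_eq0 -lt0n.
have Phi_int z : integral z -> Phi z = 0.
  move=> zi; apply/kgrid/lattice_mul/forallP => i.
  by rewrite mxE mulrA mulfV // mul1r.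
have Phi_bd : exists M, forall y, `|Phi y| <= M.
  by exists 1 => y; exact: kbounded.
have Px : Phi (to_plane q x) != 0 by rewrite /Phi to_planeK.
have [t0 [c0 [t00 t01 c0S [z [zp zi zpsi]]]]] :=
  psi_nonvanishing m3 Phi_int Phi_bd (to_plane_plane q x) Px.
case/eqP: zpsi.
pose P y := p (from_plane q y).
have Paff : cellwise_affine P := cpwl_cellwise_affine q0 pq.
have Fint : integral (to_plane q f) by apply/latticeP.
have P_ge1 a b c : plane a -> plane b -> plane c -> a + b + c = to_plane q f ->
    1 <= P a + P b + P c.
  move=> ap bp cp abc; apply: (regular_triple pR).
  by rewrite -!from_planeD abc to_planeK.
have Phi_tight a b c : tight P (to_plane q f) a b c ->
  Phi a + Phi b + Phi c = 0.
  move=> [ap bp cp abc P1]; apply: ktight => //.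
  by rewrite -!from_planeD abc to_planeK.
have zE : z = to_plane q (from_plane q z) by rewrite from_planeK.
rewrite zE; apply: (no_grid_perturbation N0 pR pE
  (k := fun y => psi m t0 c0 Phi (to_plane q y))).
- move=> s sS; apply: (psi_integral m3 _ _ Phi_int Phi_bd).
    exact: to_plane_plane.
  by apply/latticeP => //; have := lattice_mul q sS; rewrite muln1.
- move=> y s _ sS; rewrite to_planeD.
  apply: psi_periodic => //; first exact: to_plane_plane.
    by apply/latticeP => //; have := lattice_mul q sS; rewrite muln1.
  by move=> v; rewrite /Phi from_planeD to_planeK // kper.
- move=> a b c abc p1.
  apply: (psi_tight m3 t00 t01 c0S Phi_int Phi_bd Paff P_ge1 Fint Phi_tight).
  split; try exact: to_plane_plane.
    by rewrite -!to_planeD abc.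
  by rewrite /P !to_planeK.
- apply/latticeP => //; rewrite to_planeM -zE //.
Qed.

Theorem theorem7p1 (R : realType) (q : nat) (hq : (0 < q)%N)
    (m : nat) (hm : (3 <= m)%N)
    (f : 'rV[R]_2) (hf : f \in lattice R q) (hf' : f \notin lattice R 1)
    (pi : 'rV[R]_2 -> R)
    (hmin : minimal (lattice R 1) f pi) (hpl : cpwl q pi) :
  [<-> facet (lattice R 1) f pi;
       extreme (lattice R 1) f pi;
       extreme (integral_points R (m * q)) (Lattice (lattice_mul m hf))
         (fun x => pi (val x))].
Proof.
have piR := minimal_regular hmin.
have N0 : (0 < m * q)%N by rewrite muln_gt0 hq (leq_trans _ hm).
tfae.
- exact: facet_extreme.
- exact: (extreme_restriction N0 (lattice_mul m hf) hq (dvdn_mull m (dvdnn q))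
  hpl piR).
- exact: restriction_facet.
Qed.
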